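(* Let $a\ge 0$, $b\ge 1$, and let $\mathfrak{C}_{a,b}$ be the centered generalized Gaussian field on the upper half-plane $\mathbb{H}=\{z\in\mathbb{C}:\Im (z)>0\}$ with covariance kernel $$\frac{-1}{2\pi}\ln\left|\frac{z-w}{z-\bar w}\right|-\frac{(1-a)\min(|z|^2,|w|^2)}{\pi}\,\Im\Big(\frac1z\Big)\Im\Big(\frac1w\Big)-\frac{(2-b)\min(|z|^4,|w|^4)}{2\pi}\,\Im\Big(\frac1{z^2}\Big)\Im\Big(\frac1{w^2}\Big).$$ Let $\mathfrak{G}$ be a standard Gaussian Free Field on $\mathbb{H}$. For $z=\sqrt t\,e^{i\theta}$ with $t>0$, $0<\theta<\pi$, set $\eta_1(z)=\frac{-1}{\sqrt{\pi t}}B_1(t)\sin(\theta)$ and $\eta_2(z)=\frac{-1}{\sqrt{2\pi t^2}}B_2(t^2)\sin(2\theta)$, where $B_1$ and $B_2$ are two independent standard Brownian motions that are also independent of $\mathfrak{G}$. Then, with ''corresponds to'' and ''conditioned'' as defined in the context, $\mathfrak{C}_{a,b}$ is characterized as follows. 1. If $(a,b)=(1,2)$, $\mathfrak{C}_{a,b}$ corresponds to the standard Gaussian Free Field $\mathfrak{G}$. 2. If $(a,b)=(0,1)$, $\mathfrak{C}_{a,b}$ corresponds to $\mathfrak{G}$ conditioned to have first and second modes $0$. If $(a,b)=(0,2)$, $\mathfrak{C}_{a,b}$ corresponds to $\mathfrak{G}$ conditioned to have first mode $0$. If $(a,b)=(1,1)$, $\mathfrak{C}_{a,b}$ corresponds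 to $\mathfrak{G}$ conditioned to have second mode $0$. 3. If $a\ge 1$ and $b\ge 2$, $\mathfrak{C}_{a,b}$ corresponds to $\mathfrak{G}+\sqrt{a-1}\,\eta_1+\sqrt{b-2}\,\eta_2$. 4. If $0\le a<1$ and $1\le b<2$, $\mathfrak{C}_{a,b}$ corresponds to $\mathfrak{G}$ conditioned so that $\mathfrak{G}+\sqrt{\frac{a}{1-a}}\,\eta_1+\sqrt{\frac{b-1}{2-b}}\,\eta_2$ has first and second modes $0$. 5. If $0\le a<1$ and $b\ge 2$, $\mathfrak{C}_{a,b}$ corresponds to $\mathfrak{G}+\sqrt{b-2}\,\eta_2$ conditioned so that $\mathfrak{G}+\sqrt{\frac{a}{1-a}}\,\eta_1$ has first mode $0$. If $a\ge 1$ and $1\le b<2$, $\mathfrak{C}_{a,b}$ corresponds to $\mathfrak{G}+\sqrt{a-1}\,\eta_1$ conditioned so that $\mathfrak{G}+\sqrt{\frac{b-1}{2-b}}\,\eta_2$ has second mode $0$.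
   Context: **Fields and test functions.** The standard Gaussian Free Field $\mathfrak{G}$ on $\mathbb{H}$ is the centered generalized Gaussian field with covariance kernel $\frac{-1}{2\pi}\ln\left|\frac{z-w}{z-\bar w}\right|$. All fields are tested against real polynomials $f$ in $x(z)=z+\bar z=2\Re(z)$ along the half-circles $\mathcal{C}_t=\{z\in\mathbb{H}:|z|^2=t\}$, $t>0$. That is, a field $\mathfrak{F}$ is regarded as the centered jointly Gaussian family $$\mathfrak{F}(f,t)=\int_{\mathcal{C}_t}f(x(z))\,\mathfrak{F}(z)\,dx(z)=-\int_0^\pi f(2\sqrt t\cos\theta)\,\mathfrak{F}(\sqrt t e^{i\theta})\,2\sqrt t\sin\theta\,d\theta ,$$ (a fixed choice of orientation, irrelevant for the law), indexed by polynomials $f$ and $t>0$. If the field has covariance kernel $\mathcal{K}(z,w)$, then $$\mathrm{Cov}(\mathfrak{F}(f,t),\mathfrak{F}(g,t'))=\int_0^\pi\!\!\int_0^\pi f(2\sqrt t\cos\theta)\,g(2\sqrt{t'}\cos\phi)\,\mathcal{K}(\sqrt te^{i\theta},\sqrt{t'}e^{i\phi})\,4\sqrt{tt'}\sin\theta\sin\phi\,d\theta\,d\phi .$$ For the field $\mathfrak{C}_{a,b}$ the parameters range over $a\ge 0$, $b\ge 1$ (they arise as $a=\mathbb{E}[X_{1,1}^2]$ and $b=\mathbb{E}[|X_{1,2}|^4]$ for entries of a complex Hermitian Wigner matrix with $\mathbb{E}|X_{1,2}|^2=1$). **''Corresponds to''.** Two fields correspond to each other if they have the same law, i.e. the centered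 Gaussian families $(\mathfrak{F}(f,t))_{f,t}$ have the same covariances. **Modes.** The first mode of a field $\mathfrak{F}$ is the family $\int_0^\pi\mathfrak{F}(\sqrt te^{i\theta})\sin(\theta)\,d\theta$, $t>0$ (up to a scalar depending on $t$, this is $\mathfrak{F}(1,t)$). The second mode is the family $\int_0^\pi\mathfrak{F}(\sqrt te^{i\theta})\sin(2\theta)\,d\theta$, $t>0$ (up to a scalar depending on $t$, this is $\mathfrak{F}(x,t)$). A field has first (resp. second) mode $0$ if these integrals vanish for every $t>0$. **Conditioning.** Let $\mathcal{H}$ be the Gaussian Hilbert space (closed linear span in $L^2$, with inner product given by covariance) generated by all variables $\mathfrak{G}(f,t)$, $\eta_1(f,t)$, $\eta_2(f,t)$. For a closed linear subspace $K\subset\mathcal{H}$ with orthogonal projection $\mathrm{P}_K:\mathcal{H}\to K$, the field $\mathfrak{F}$ conditioned with respect to $K$ (i.e. conditioned on all elements of $K$ being $0$) is the field $\mathfrak{F}-\mathrm{P}_K[\mathfrak{F}]$, i.e. $(f,t)\mapsto\mathfrak{F}(f,t)-\mathrm{P}_K[\mathfrak{F}(f,t)]$. ''$\mathfrak{F}$ conditioned so that $\mathfrak{F}'$ has first mode $0$'' (resp. second mode $0$; first and second modes $0$) means $\mathfrak{F}$ conditioned with respect to the closed linear span $K$ of the first mode (resp. second mode; both modes) of $\mathfrak{F}'$ for all $t>0$. ''$\mathfrak{F}$ conditioned to have a mode $0$'' is the case $\mathfrak{F}'=\mathfrak{F}$. *)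

(* Defs.v *)
From HB Require Import structures.
From mathcomp Require Import all_boot all_order all_algebra.
From mathcomp Require Import all_classical all_reals all_analysis.
From mathcomp Require Import complex.

Set Implicit Arguments.
Unset Strict Implicit.
Unset Printing Implicit Defensive.

Import Order.TTheory GRing.Theory Num.Theory.
Import numFieldNormedType.Exports.

Local Open Scope classical_set_scope.
Local Open Scope complex_scope.
Local Open Scope ring_scope.

(* The law N(0, s ^ 2). The library's [normal_prob 0 0] is the uniform law on
   [0, 1], so the degenerate case is treated apart. *)
Definition centered_normal_law {R : realType} (s : R) (A : set R) : \bar R :=
  if s == 0 then \d_(0 : R) A else normal_prob 0 s A.

Section random.
Context {d : measure_display} {T : measurableType d} {R : realType}.
Variable P : probability T R.
Implicit Types (X Y Z : T -> R).

Definition has_centered_normal_law (s : R) X :=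
  measurable_fun [set: T] X /\
  forall A : set R, measurable A -> P (X @^-1` A) = centered_normal_law s A.

Definition independent (S1 S2 : set (set T)) :=
  forall A B : set T, S1 A -> S2 B -> P (A `&` B) = (P A * P B)%E.

Definition sigma_of {I : Type} (D : set I) (X : I -> T -> R) : set (set T) :=
  <<s \bigcup_(i in D) preimage_set_system [set: T] (X i) measurable >>.

Definition brownian_motion (B : R -> T -> R) :=
  [/\ {ae P, forall w, B 0 w = 0},
      forall s t : R, 0 <= s -> s <= t ->
        has_centered_normal_law (Num.sqrt (t - s)) (B t \- B s),
      forall s t : R, 0 <= s -> s <= t ->
        independent (sigma_of [set u | 0 <= u <= s] B)
                    (sigma_of [set t] (fun u => B u \- B s)),
      forall t : R, 0 <= t -> measurable_fun [set: T] (B t) &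
      {ae P, forall w, {within `[0, +oo[, continuous (fun t => B t w)}}].

Definition linear_span (S : set (T -> R)) : set (T -> R) :=
  [set Z | exists (n : nat) (c : 'I_n -> R) (X : 'I_n -> T -> R),
     (forall i, S (X i)) /\ Z = (fun w => \sum_(i < n) c i * X i w)].

(* Closure in L^2(P). Elements are functions rather than classes modulo
   P-almost sure equality. *)
Definition closed_span (S : set (T -> R)) : set (T -> R) :=
  [set Y | Y \in Lfun P 2%:E /\
     forall e : R, 0 < e -> exists2 Z, linear_span S Z &
       ('N[P]_2%:E[EFin \o (Y \- Z)%R] < e%:E)%E].

(* A version of P_K[X]; it is determined up to P-almost sure equality. *)
Definition orth_proj (K : set (T -> R)) X : T -> R :=
  xget (cst 0)
    [set Y | K Y /\ forall Z, K Z -> covariance P (X \- Y) Z = 0%E].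

End random.

(* A (generalized) field tested along the half-circles: F f t stands for
   F(f,t), and is only meaningful for t > 0. *)
Definition gfield (R : realType) (T : Type) := {poly R} -> R -> T -> R.

Section fields.
Context {d : measure_display} {T : measurableType d} {R : realType}.
Implicit Types (F : gfield R T) (K : set (T -> R)).

Definition add_field F (c : R) F' : gfield R T :=
  fun f t w => F f t w + c * F' f t w.

(* The field given by a random function of (t, theta), i.e. of the point
   sqrt t * e^(i theta). *)
Definition field_of_fun (h : R -> R -> T -> R) : gfield R T := fun f t w =>
  - \int[lebesgue_measure]_(theta in `]0, pi[)
      (f.[2 * Num.sqrt t * cos theta] * h t theta w
       * (2 * Num.sqrt t * sin theta)).

Definition eta1 (B1 : R -> T -> R) : gfield R T :=
  field_of_fun (fun t theta w =>
    - 1 / Num.sqrt (pi * t) * B1 t w * sin theta).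

Definition eta2 (B2 : R -> T -> R) : gfield R T :=
  field_of_fun (fun t theta w =>
    - 1 / Num.sqrt (2 * pi * t ^+ 2) * B2 (t ^+ 2) w * sin (2 * theta)).

(* The integral of F(sqrt t * e^(i theta)) * sin theta over theta: with f = 1,
   F(f,t) is - 2 sqrt t times that integral. *)
Definition first_mode F (t : R) : T -> R :=
  fun w => - F 1 t w / (2 * Num.sqrt t).

(* The same with sin (2 theta): with f = 'X, 2 sqrt t cos theta * 2 sqrt t
   sin theta = 2 t sin (2 theta). *)
Definition second_mode F (t : R) : T -> R :=
  fun w => - F 'X t w / (2 * t).

Definition first_modes F : set (T -> R) :=
  [set first_mode F t | t in [set t | 0 < t]].

Definition second_modes F : set (T -> R) :=
  [set second_mode F t | t in [set t | 0 < t]].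

Variable P : probability T R.

Definition centered_gaussian F :=
  forall (n : nat) (c : 'I_n -> R) (f : 'I_n -> {poly R}) (t : 'I_n -> R),
    (forall i, 0 < t i) ->
    exists s : R, has_centered_normal_law P s
      (fun w => \sum_(i < n) c i * F (f i) (t i) w).

(* F conditioned on all elements of the closed linear span of S being 0. *)
Definition conditioned F (S : set (T -> R)) : gfield R T :=
  fun f t => F f t \- orth_proj P (closed_span P S) (F f t).

(* The law of the polynomial-indexed field F is independent of (B1, B2), and
   B1 is independent of B2. *)
Definition independent_noises F (B1 B2 : R -> T -> R) :=
  let sB1 := sigma_of [set t | 0 <= t] B1 in
  let sB2 := sigma_of [set t | 0 <= t] B2 in
  let sF := sigma_of [set i | 0 < i.2] (fun i : {poly R} * R => F i.1 i.2) in
  independent P sB1 sB2 /\ independent P sF <<s sB1 `|` sB2 >>.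

End fields.

Section kernels.
Context {R : realType}.
Implicit Types (z w : R[i]).

Definition polar (t theta : R) : R[i] :=
  (Num.sqrt t * cos theta) +i* (Num.sqrt t * sin theta).

Definition kernel_covariance (k : R[i] -> R[i] -> R)
    (f : {poly R}) (t : R) (g : {poly R}) (t' : R) : R :=
  \int[lebesgue_measure]_(theta in `]0, pi[)
    \int[lebesgue_measure]_(phi in `]0, pi[)
      (f.[2 * Num.sqrt t * cos theta] * g.[2 * Num.sqrt t' * cos phi]
       * k (polar t theta) (polar t' phi)
       * (4 * Num.sqrt (t * t') * sin theta * sin phi)).

Definition gff_kernel z w : R :=
  - 1 / (2 * pi) * ln (Normc.normc ((z - w) / (z - w^*))).

Definition Cab_kernel (a b : R) z w : R :=
  gff_kernel z w
  - (1 - a) * Num.min (Normc.normc z ^+ 2) (Normc.normc w ^+ 2) / pi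
    * complex.Im (1 / z) * complex.Im (1 / w)
  - (2 - b) * Num.min (Normc.normc z ^+ 4) (Normc.normc w ^+ 4) / (2 * pi)
    * complex.Im (1 / z ^+ 2) * complex.Im (1 / w ^+ 2).

End kernels.

Section laws.
Context {R : realType}.
Context {d : measure_display} {T : measurableType d} (P : probability T R).
Context {d' : measure_display} {T' : measurableType d'}.
Variable P' : probability T' R.

Definition gaussian_field_with_kernel (F : gfield R T) (k : R[i] -> R[i] -> R) :=
  centered_gaussian P F /\
  forall (f g : {poly R}) (t t' : R), 0 < t -> 0 < t' ->
    covariance P (F f t) (F g t') = (kernel_covariance k f t g t')%:E.

Definition corresponds (F : gfield R T) (F' : gfield R T') :=
  [/\ centered_gaussian P F, centered_gaussian P' F' &
      forall (f g : {poly R}) (t t' : R), 0 < t -> 0 < t' ->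
        covariance P (F f t) (F g t') = covariance P' (F' f t) (F' g t')].

End laws.

(* Main.v *)
(** In polar coordinates the covariance kernel of the free field is
    log_kernel / (4 pi), a function of the angles and of the ratio rho <= 1 of
    the radii, and integrating it against sin phi, resp. sin (2 phi), returns
    an explicit multiple of sin theta, resp. sin (2 theta). This is read off
    explicit primitives when rho < 1 and obtained by monotone convergence when
    rho = 1. Hence G(f,t) has covariance u_k(f,t) v_k(t,t') with its k-th mode
    at t', where v_1 = pi min(t,t') and v_2 = (pi/2) min(t^2,t'^2). The noises
    have the very same shape: eta_k(f,t) = u_k(f,t) N_k(t) with N_k of
    covariance v_k. So the projection of G(f,t) on the closed span of the modes
    of G + b_k eta_k is 1 / (1 + b_k^2) times u_k(f,t) times the mode at the
    same t, with no limit to be taken, and in every case the covariance is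
    Cov_G + sum_k (a_k^2 - q_k) u_k(f,t) u_k(g,t') v_k(t,t'), where a_k is the
    amplitude of eta_k and q_k is 1 / (1 + b_k^2) or 0. *)

Require Import Defs.
From HB Require Import structures.
From mathcomp Require Import all_boot all_order all_algebra.
From mathcomp Require Import all_classical all_reals all_analysis.
From mathcomp Require Import measurable_realfun complex ring lra.

Set Implicit Arguments.
Unset Strict Implicit.
Unset Printing Implicit Defensive.

Import Order.TTheory GRing.Theory Num.Theory.
Import numFieldNormedType.Exports.

Local Open Scope classical_set_scope.
Local Open Scope ring_scope.

(** * Gaussian laws *)

(** Correspondence asks for Gaussian laws and not only for equal covariances. Every variable
    involved, explicit projections included, lies in the algebraic span of [G], [B1] and [B2], whose
    elements are sums of three independent centered normal variables. Stability of these laws under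
    independent sums, zero variances included, is therefore the main probabilistic input.

    [orth_proj] selects an arbitrary version, so a conditioned field is known only almost surely;
    its law and its covariances are carried over from an explicit version.

    The weight 1 / (1 + b_k^2) is a regression coefficient: noise multiplies the covariance of the
    mode by 1 + b_k^2, while the covariance of the mode with the conditioned field, which carries no
    noise in that mode, is unchanged. Solving 1 / (1 + x^2) = 1 - a and 1 / (1 + x^2) = 2 - b gives
    the amplitudes x^2 = a / (1 - a) and x^2 = (b - 1) / (2 - b) of the theorem, and vanishing
    amplitudes give its first two points. *)

Section affine_change.
Context {R : realType}.
Local Notation mu := (@lebesgue_measure R).

Definition affine (c d : R) : measurableTypeR R -> measurableTypeR R :=
  fun x => c * x + d.

Lemma measurable_affine c d : measurable_fun setT (affine c d).
Proof. by apply: measurable_funD => //; exact: measurable_funM. Qed.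

(** Uniqueness of Lebesgue measure reduces this to intervals ]a, b]. A negative slope turns the
    preimage into an interval closed on the left, so the two signs of [c] are treated apart. *)
Lemma lebesgue_measure_affine (c d : R) (A : set R) : c != 0 -> measurable A ->
  mu A = (`|c|%:E * pushforward mu (affine c d) A)%E.
Proof.
move=> c0.
pose phi : {mfun measurableTypeR R >-> measurableTypeR R} :=
  HB.pack (affine c d) (isMeasurableFun.Build _ _ _ _ _ (measurable_affine c d)).
pose k : {nonneg R} := NngNum (normr_ge0 c).
apply: (lebesgue_measure_unique (mu := mscale k (pushforward mu phi))) => //= _ [[a b]] _ <-.
rewrite /mscale/= /pushforward /k /=.
have [cp|cn|] := ltgtP c 0; last by move/eqP: c0.
- have -> : affine c d @^-1` [set` `]a, b]] = [set` `[(b - d) / c, (a - d) / c[].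
    apply/seteqP; split => x /=; rewrite !in_itv/= /affine.
      move=> /andP[ax xb]; apply/andP; split.
        by rewrite ler_ndivrMr// lerBrDr mulrC.
      by rewrite ltr_ndivlMr// ltrBlDr mulrC.
    move=> /andP[]; rewrite ler_ndivrMr// lerBrDr mulrC => xb.
    by rewrite ltr_ndivlMr// ltrBlDr mulrC => ax; rewrite ax.
  rewrite !lebesgue_measure_itv/= !lte_fin ltr_ndivrMr// divfK ?lt_eqF//.
  rewrite ltrD2r; case: ifPn => ab; last by rewrite mule0.
  rewrite -!EFinD -EFinM ltr0_norm//; congr EFin; field; exact: c0.
- have -> : affine c d @^-1` [set` `]a, b]] = [set` `](a - d) / c, (b - d) / c]].
    apply/seteqP; split => x /=; rewrite !in_itv/= /affine.
      move=> /andP[ax xb]; apply/andP; split.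
        by rewrite ltr_pdivrMr// ltrBlDr mulrC.
      by rewrite ler_pdivlMr// lerBrDr mulrC.
    move=> /andP[]; rewrite ltr_pdivrMr// ltrBlDr mulrC => xb.
    by rewrite ler_pdivlMr// lerBrDr mulrC => ax; rewrite xb.
  rewrite !lebesgue_measure_itv/= !lte_fin ltr_pdivrMr// divfK ?gt_eqF//.
  rewrite ltrD2r; case: ifPn => ab; last by rewrite mule0.
  rewrite -!EFinD -EFinM gtr0_norm//; congr EFin; field; exact: c0.
Qed.

Lemma ge0_integral_affine (c d : R) (f : R -> \bar R) : c != 0 ->
  measurable_fun setT f -> (forall x, 0 <= f x)%E ->
  (\int[mu]_x f (c * x + d)%R = (`|c|^-1)%:E * \int[mu]_x f x)%E.
Proof.
move=> c0 mf f0.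
pose phi : {mfun measurableTypeR R >-> measurableTypeR R} :=
  HB.pack (affine c d) (isMeasurableFun.Build _ _ _ _ _ (measurable_affine c d)).
pose k : {nonneg R} := NngNum (normr_ge0 c).
have E : (\int[mu]_x f x = \int[mscale k (pushforward mu phi)]_x f x)%E.
  move=> mphi.
  apply: eq_measure_integral => A mA _.
  exact: (lebesgue_measure_affine d c0).
have -> := E (measurable_affine c d).
rewrite ge0_integral_mscale//= (ge0_integral_pushforward (measurable_affine c d))//= muleA -EFinM.
by rewrite mulVf ?normr_eq0// mul1e preimage_setT.
Qed.

End affine_change.

Section density.
Context d (T : measurableType d) {R : realType}.
Variables (mu : {sigma_finite_measure set T -> \bar R})
  (nu : {finite_measure set T -> \bar R}) (g : T -> R).
Hypotheses (g0 : forall x, 0 <= g x) (mg : measurable_fun setT g)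
  (nuE : forall A, measurable A -> (nu A = \int[mu]_(x in A) (g x)%:E)%E).

(** The change of variables is known for the Radon-Nikodym derivative of [nu], and that derivative
    equals [g] almost everywhere because both integrate to [nu] over every measurable set. *)
Lemma ge0_integral_density (f : T -> \bar R) :
  measurable_fun setT f -> (forall x, 0 <= f x)%E ->
  (\int[nu]_x f x = \int[mu]_x (f x * (g x)%:E))%E.
Proof.
move=> mf f0.
have dom : nu `<< mu.
  apply/null_content_dominatesP => A mA A0; rewrite nuE//.
  by apply: null_set_integral => //; apply: measurable_funTS; exact/measurable_EFinP.
rewrite -(Radon_Nikodym_SigmaFinite.change_of_variables dom)//.
have mh := Radon_Nikodym_SigmaFinite.f_integrable dom.
apply: ae_eq_integral => //.
- apply: emeasurable_funM => //; exact: measurable_int mh.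
- by apply: emeasurable_funM => //; exact/measurable_EFinP.
- have : ae_eq mu setT (Radon_Nikodym_SigmaFinite.f nu mu) (EFin \o g).
    apply: integral_ae_eq => //.
    + exact/measurable_EFinP.
    + move=> A _ mA; rewrite -nuE//.
      by rewrite -Radon_Nikodym_SigmaFinite.f_integral.
  by apply: filterS => x /[apply] /= ->.
Qed.

End density.

(** * The standard normal law: scaling, second moment, rotation invariance *)

Section standard_normal.
Context {R : realType}.
Local Notation mu := (@lebesgue_measure R).
Local Notation phi := (normal_pdf 0 1 : R -> R).

Lemma normal_pdf01E (x : R) : phi x = normal_peak 1 * expR (- (x ^+ 2 / 2)).
Proof.
by rewrite normal_pdfE ?oner_neq0// /normal_fun subr0 expr1n mulNr.
Qed.

(* Seeing N(0, s^2) as the image of N(0, 1) by x |-> s x also covers s = 0. *)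
Lemma centered_normal_lawE (s : R) (A : set R) : measurable A ->
  centered_normal_law s A = normal_prob 0 1 [set x | A (s * x)].
Proof.
move=> mA; rewrite /centered_normal_law; case: eqVneq => [->|s0].
  rewrite diracE; case: (boolP (0 \in A)) => [/set_mem A0|A0].
    rewrite (_ : [set x | _] = setT) ?probability_setT//.
    by apply/seteqP; split => x //= _; rewrite mul0r.
  rewrite (_ : [set x | _] = set0) ?measure0//.
  by apply/seteqP; split => x //=; rewrite mul0r => /mem_set; rewrite (negbTE A0).
have mB : measurable [set x : R | A (s * x)].
  rewrite -[X in measurable X]setTI.
  exact: (@measurable_funM _ _ _ _ (cst s) id).
rewrite /normal_prob integral_mkcond [RHS]integral_mkcond.
have mp t : measurable_fun setT (EFin \o normal_pdf (0 : R) t).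
  by apply/measurable_EFinP; exact: measurable_normal_pdf.
have := @ge0_integral_affine R s 0 ((EFin \o normal_pdf 0 s) \_ A) s0.
rewrite -/mu => /(_ ((measurable_restrictT _ mA).1 (measurable_funTS (mp s)))).
have h0 (x : R) : (0 <= ((EFin \o normal_pdf 0 s) \_ A) x)%E.
  by apply: erestrict_ge0 => y _; rewrite lee_fin normal_pdf_ge0.
move=> /(_ h0) h.
have -> : (\int[mu]_x ((EFin \o normal_pdf 0 s) \_ A) x =
   `|s|%:E * \int[mu]_x ((EFin \o normal_pdf 0 s) \_ A) (s * x + 0)%R)%E.
  by rewrite h muleA -EFinM mulfV ?normr_eq0// mul1e.
rewrite -ge0_integralZl//.
  apply: eq_integral => x _; rewrite /patch/= addr0.
  rewrite (_ : (x \in [set x | A (s * x)]) = (s * x \in A)).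
    case: ifPn => _; last by rewrite mule0.
    rewrite -EFinM; congr EFin.
    (* The Jacobian |s| cancels the 1 / |s| in the peak of N(0, s^2), and the exponent at s x is
       that of N(0, 1) at x. *)
    rewrite normal_pdf01E normal_pdfE// /normal_fun /normal_peak.
    rewrite subr0 mulrA; congr (_ * _).
      rewrite expr1n mul1r -mulrnAr sqrtrM ?sqr_ge0// sqrtr_sqr invfM.
      by rewrite mulrA divff ?mul1r// normr_eq0.
    by congr expR; field.
  by apply/idP/idP => /set_mem H; apply/mem_set.
apply: (measurableT_comp (f := (EFin \o normal_pdf 0 s) \_ A)).
  exact: ((measurable_restrictT _ mA).1 (measurable_funTS (mp s))).
exact: measurable_affine.
Qed.

Lemma ge0_integral_normal01 (f : R -> \bar R) :
  measurable_fun setT f -> (forall x, 0 <= f x)%E ->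
  (\int[normal_prob (0 : R) 1]_x f x = \int[mu]_x (f x * (phi x)%:E))%E.
Proof.
move=> mf f0; apply: (@ge0_integral_density _ _ R mu (normal_prob 0 1)) => //.
- exact: measurable_normal_pdf.
Qed.

End standard_normal.

Section ftc.
Context {R : realType}.
Local Notation mu := (@lebesgue_measure R).

Lemma integral_itv_is_derive (f F : R -> R) (a b : R) : a < b ->
  (forall x : R, is_derive x (1 : R) F (f x)) -> continuous f ->
  (\int[mu]_(x in `[a, b]) (f x)%:E = (F b - F a)%:E)%E.
Proof.
move=> ab dF cf.
have cF : continuous F.
  by move=> x; apply: differentiable_continuous; apply/derivable1_diffP; case: (dF x).
rewrite (@continuous_FTC2 _ f F)//.
- by apply: continuous_subspaceT.
- split; [by move=> x _; case: (dF x)|exact/cvg_at_right_filter/cF|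
    exact/cvg_at_left_filter/cF].
- by move=> x _; rewrite derive1E; have -> := @derive_val _ _ _ _ _ _ _ (dF x).
Qed.

End ftc.

Section normal_moments.
Context {R : realType}.
Local Notation mu := (@lebesgue_measure R).
Local Notation phi := (normal_pdf 0 1 : R -> R).

Lemma is_derive_normal_pdf01 (x : R) : is_derive x (1 : R) phi (- x * phi x).
Proof.
rewrite (_ : phi = fun x => normal_peak 1 * expR (- (x ^+ 2 / 2))); last first.
  by apply/funext => y; rewrite normal_pdf01E.
apply: is_derive_eq.
by rewrite /GRing.scale/=; field.
Qed.

Lemma continuous_normal_pdf01 : continuous phi.
Proof. exact: continuous_normal_pdf (oner_neq0 _). Qed.

Lemma normal_pdf01N (x : R) : phi (- x) = phi x.
Proof. by rewrite !normal_pdf01E sqrrN. Qed.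

(** From exp (x^2 / 2) >= 1 + x^2 / 2 one gets x phi(x) <= 2 [normal_peak] / x, a multiple of the
    harmonic sequence. This is the boundary term of the second moment. *)
Lemma cvg_id_normal_pdf01 : (n.+1%:R * phi n.+1%:R) @[n --> \oo] --> (0 : R).
Proof.
have c : (2 * normal_peak 1 * n.+1%:R^-1 : R) @[n --> \oo] --> (0 : R).
  by rewrite -(mulr0 (2 * normal_peak 1)); apply: cvgMr; exact: cvg_harmonic.
apply: (squeeze_cvgr _ (cvg_cst 0) c).
apply: nearW => n; rewrite normal_pdf01E mulr_ge0 ?mulr_ge0 ?normal_peak_ge0 ?expR_ge0//=.
set x : R := n.+1%:R; have x0 : 0 < x by rewrite ltr0n.
rewrite mulrCA mulrAC -mulrA [leRHS]mulrAC mulrC ler_wpM2r ?normal_peak_ge0//.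
rewrite expRN ler_pdivrMr ?expR_gt0//.
apply: (@le_trans _ _ (2 / x * (1 + x * (2^-1 * x)))); last first.
  by apply: ler_wpM2l; [rewrite divr_ge0// ltW|exact: expR_ge1Dx].
have -> : 2 / x * (1 + x * (2^-1 * x)) = 2 / x + x by field; rewrite gt_eqF.
by rewrite lerDr divr_ge0// ltW.
Qed.

(** The function - x phi has derivative x^2 phi - phi, so over [-n-1, n+1] the integrals of x^2 phi
    and of phi differ by - 2 (n+1) phi(n+1), which tends to 0; the second integral tends to the
    total mass 1. *)
Lemma integral_sqr_normal01 :
  (\int[normal_prob (0 : R) 1]_x (x ^+ 2)%:E = 1)%E.
Proof.
rewrite ge0_integral_normal01//; last 2 first.
  by apply/measurable_EFinP; exact: exprn_measurable.
  by move=> x; rewrite lee_fin sqr_ge0.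
under eq_integral do rewrite -EFinM.
pose I (n : nat) := `[- n.+1%:R, n.+1%:R]%classic : set R.
have mI n : measurable (I n) by exact: measurable_itv.
have IT : \bigcup_n I n = setT.
  apply/seteqP; split => // x _.
  exists (Num.truncn `|x|); first by [].
  rewrite /I/= in_itv/= -ler_norml.
  exact/ltW/truncnS_gt.
have ndI : nondecreasing_seq I.
  move=> m n mn; apply/subsetPset => x; rewrite /I/= !in_itv/= => /andP[mx xm].
  have mn' : m.+1%:R <= n.+1%:R :> R by rewrite ler_nat.
  by apply/andP; split; lra.
have m1 : measurable_fun setT (fun x : R => (phi x)%:E).
  by apply/measurable_EFinP; exact: measurable_normal_pdf.
have m2 : measurable_fun setT (fun x : R => (x ^+ 2 * phi x)%:E).
  apply/measurable_EFinP; apply: measurable_funM; last exact: measurable_normal_pdf.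
  exact: exprn_measurable.
have p1 (x : R) : (0 <= (phi x)%:E)%E by rewrite lee_fin normal_pdf_ge0.
have p2 (x : R) : (0 <= (x ^+ 2 * phi x)%:E)%E.
  by rewrite lee_fin mulr_ge0 ?sqr_ge0 ?normal_pdf_ge0.
have c1 : (\int[mu]_(x in I n) (phi x)%:E)%E @[n --> \oo] --> 1%E.
  rewrite -(integral_normal_pdf (0 : R) 1) -IT.
  by apply: ge0_nondecreasing_set_cvg_integral => // n; exact: measurable_funTS.
have c2 : (\int[mu]_(x in I n) (x ^+ 2 * phi x)%:E)%E @[n --> \oo] -->
    (\int[mu]_x (x ^+ 2 * phi x)%:E)%E.
  rewrite -IT.
  by apply: ge0_nondecreasing_set_cvg_integral => // n; exact: measurable_funTS.
have i1 n : mu.-integrable (I n) (EFin \o phi).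
  apply: continuous_compact_integrable; first exact: segment_compact.
  by apply: continuous_subspaceT => x; exact: continuous_normal_pdf01.
have cg : continuous (fun x : R => x ^+ 2 * phi x - phi x).
  move=> x; apply: cvgB; last exact: continuous_normal_pdf01.
  apply: cvgM; last exact: continuous_normal_pdf01.
  exact: exprn_continuous.
have i2 n : mu.-integrable (I n) (EFin \o (fun x : R => x ^+ 2 * phi x - phi x)).
  apply: continuous_compact_integrable; first exact: segment_compact.
  exact: continuous_subspaceT.
have E n : (\int[mu]_(x in I n) (x ^+ 2 * phi x)%:E =
    \int[mu]_(x in I n) (phi x)%:E + (- 2 * (n.+1%:R * phi n.+1%:R))%:E)%E.
  have := @integral_itv_is_derive R (fun x => x ^+ 2 * phi x - phi x)
    (fun x => - (x * phi x)) (- n.+1%:R) n.+1%:R.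
  move=> /(_ _ _ cg) ftc.
  transitivity (\int[mu]_(x in I n) ((phi x)%:E + (x ^+ 2 * phi x - phi x)%:E))%E.
    by apply: eq_integral => x _; rewrite -EFinD addrC subrK.
  transitivity (\int[mu]_(x in I n) (phi x)%:E +
      \int[mu]_(x in I n) (x ^+ 2 * phi x - phi x)%:E)%E.
    by apply: integralD; [exact: mI|exact: i1|exact: i2].
  have ab : - n.+1%:R < n.+1%:R :> R by rewrite gtrN// ltr0n.
  have dd (x : R) : is_derive x (1 : R) (fun x => - (x * phi x)) (x ^+ 2 * phi x - phi x).
    have dphi := is_derive_normal_pdf01 x.
    by apply: is_derive_eq; rewrite /GRing.scale/=; ring.
  congr (_ + _)%E; rewrite /I (ftc ab dd); congr EFin.
  by rewrite normal_pdf01N; ring.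
suff c3 : (\int[mu]_(x in I n) (x ^+ 2 * phi x)%:E)%E @[n --> \oo] --> 1%E.
  by apply: (cvg_unique _ c2 c3).
under eq_fun do rewrite E.
suff : (\int[mu]_(x in I n) (phi x)%:E + (- 2 * (n.+1%:R * phi n.+1%:R))%:E)%E
    @[n --> \oo] --> (1 + 0)%E by rewrite adde0.
apply: cvgeD => //; apply: cvg_EFin; first by apply: nearW.
suff : (- 2 * (n.+1%:R * phi n.+1%:R)) @[n --> \oo] --> (- 2 * 0 : R) by rewrite mulr0.
by apply: cvgMr; exact: cvg_id_normal_pdf01.
Qed.

Lemma normal_prob01E (B : set R) : measurable B ->
  normal_prob 0 1 B = (\int[mu]_x (\1_B x * phi x)%:E)%E.
Proof.
move=> mB; rewrite /normal_prob integral_mkcond; apply: eq_integral => x _.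
by rewrite patchE indicE; case: ifPn => _; rewrite ?mul1r ?mul0r.
Qed.

(* Substitute v = (s1 x + s2 y) / s, then exchange the integrals: the exponents
   satisfy x^2 + ((s v - s1 x) / s2)^2 = v^2 + ((s x - s1 v) / s2)^2. *)
Lemma normal_prob01_rotation (s1 s2 s : R) (A : set R) : s2 != 0 ->
  s ^+ 2 = s1 ^+ 2 + s2 ^+ 2 -> measurable A ->
  (\int[normal_prob (0%R : R) 1]_x normal_prob 0 1 [set y : R | A (s1 * x + s2 * y)%R] =
   normal_prob 0 1 [set v : R | A (s * v)%R])%E.
Proof.
move=> s20 ss mA.
have s0 : s != 0.
  by rewrite -sqrf_eq0 ss gt_eqF// ltr_wpDl ?sqr_ge0// exprn_even_gt0.
have mphi : measurable_fun [set: R] phi by exact: measurable_normal_pdf.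
have mlin (a b : R) : measurable_fun [set: R] (fun x => a * x + b) by exact: measurable_affine.
have mA' (a b : R) : measurable [set y : R | A (b + a * y)].
  rewrite -[X in measurable X]setTI.
  by have := mlin a b measurableT A mA; under [X in X @^-1` _]eq_fun do rewrite addrC.
have mas : measurable [set y : R | A (s * y)].
  have := mA' s 0; rewrite (_ : [set y | _] = [set y | A (s * y)])//.
  by apply/seteqP; split => y /=; rewrite add0r.
have mprod (a b : R) : measurable_fun setT (fun z : R * R => a * z.1 + b * z.2).
  by apply: measurable_funD; apply: measurable_funM.
have m1A : measurable_fun [set: R] (\1_A : R -> R) by exact: measurable_indic.
have inner (x : R) : normal_prob 0 1 [set y : R | A (s1 * x + s2 * y)] =
   (\int[mu]_v (`|s / s2| * (\1_A (s * v) * phi (s / s2 * v - s1 / s2 * x)))%:E)%E.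
  rewrite normal_prob01E//.
  have := @ge0_integral_affine R (s / s2) (- (s1 / s2 * x))
    (fun y => (\1_[set y : R | A (s1 * x + s2 * y)] y * phi y)%:E).
  have -> : s / s2 != 0 by rewrite mulf_neq0 ?invr_neq0.
  move=> /(_ erefl) /(_ _ _) h.
  transitivity (`|s / s2|%:E * ((`|s / s2|^-1)%:E *
     \int[mu]_y (\1_[set y | A (s1 * x + s2 * y)] y * phi y)%:E))%E.
    by rewrite muleA -EFinM mulfV ?mul1e// normr_eq0 mulf_neq0 ?invr_neq0.
  rewrite -h; last 2 first.
  - by apply/measurable_EFinP/measurable_funM => //; exact: measurable_indic.
  - by move=> y; rewrite lee_fin mulr_ge0 ?normal_pdf_ge0.
  rewrite -ge0_integralZl//; last 2 first.
  - apply/measurable_EFinP.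
    apply: (measurableT_comp (f := fun y => \1_[set y : R | A (s1 * x + s2 * y)] y * phi y))
        (mlin _ _).
    by apply: measurable_funM => //; exact: measurable_indic.
  - by move=> y _; rewrite lee_fin mulr_ge0 ?normal_pdf_ge0.
  apply: eq_integral => v _; rewrite -EFinM; congr (_ * (_ * _))%:E.
  rewrite !indicE; congr (nat_of_bool _)%:R.
  have e : s1 * x + s2 * (s / s2 * v - s1 / s2 * x) = s * v by field.
  by apply/idP/idP => /set_mem /= H; apply/mem_set; rewrite /= ?e // -e.
have mS : measurable [set z : R * R | A (s1 * z.1 + s2 * z.2)].
  by rewrite -[X in measurable X]setTI; exact: mprod.
have xS (x : R) : [set y : R | A (s1 * x + s2 * y)] =
    xsection [set z : R * R | A (s1 * z.1 + s2 * z.2)] x.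
  by apply/seteqP; split => y; rewrite /xsection/= inE.
rewrite ge0_integral_normal01//; last first.
- under eq_fun do rewrite xS.
  exact: (measurable_fun_xsection (normal_prob 0 1) mS).
under eq_integral => x _.
  rewrite inner muleC -ge0_integralZl//; last 3 first.
  - apply/measurable_EFinP; apply: measurable_funM => //; apply: measurable_funM.
      by apply: (measurableT_comp (f := \1_A : R -> R)) => //; exact: measurable_funM.
    by apply: (measurableT_comp (f := phi)) => //; exact: mlin.
  - by move=> y _; rewrite lee_fin !mulr_ge0 ?normal_pdf_ge0.
  - by rewrite lee_fin normal_pdf_ge0.
  over.
have pp x v : phi x * phi (s / s2 * v - s1 / s2 * x) =
              phi v * phi (s / s2 * x - s1 / s2 * v).
  rewrite !normal_pdf01E mulrACA [RHS]mulrACA; congr (_ * _).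
  rewrite -!expRD; congr expR.
  have : s ^+ 2 - s1 ^+ 2 = s2 ^+ 2 by rewrite ss addrC addKr.
  move=> e.
  apply/eqP; rewrite -subr_eq0; apply/eqP.
  transitivity ((v ^+ 2 - x ^+ 2) * (s2 ^+ 2 - (s ^+ 2 - s1 ^+ 2)) / (2 * s2 ^+ 2)).
    by field.
  by rewrite e subrr mulr0 mul0r.
rewrite (fubini_tonelli (m1 := mu) (m2 := mu) (fun z => (phi z.1)%:E *
   (`|s / s2| * (\1_A (s * z.2) * phi (s / s2 * z.2 - s1 / s2 * z.1)))%:E)%E)/=; last 2 first.
- apply/measurable_EFinP; apply: measurable_funM.
    by apply: (measurableT_comp mphi); exact: measurable_fst.
  apply: measurable_funM => //; apply: measurable_funM.
    apply: (measurableT_comp m1A); apply: measurable_funM => //.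
  apply: (measurableT_comp mphi).
  have := mprod (- (s1 / s2)) (s / s2).
  by apply: eq_measurable_fun => z _; rewrite /= mulNr addrC.
- by move=> z; rewrite -EFinM lee_fin !mulr_ge0 ?normal_pdf_ge0.
rewrite normal_prob01E//; apply: eq_integral => v _.
transitivity (\int[mu]_x ((`|s / s2| * \1_A (s * v) * phi v)%:E * (phi (s / s2 * x - s1 / s2 *
    v))%:E))%E.
  by apply: eq_integral => x _; rewrite -!EFinM; congr EFin; rewrite [LHS]mulrCA mulrA -mulrA;
    rewrite [RHS]mulrAC; ring: (pp x v).
rewrite ge0_integralZl//; last 3 first.
- by apply/measurable_EFinP; apply: (measurableT_comp mphi); exact: mlin.
- by move=> y _; rewrite lee_fin ?normal_pdf_ge0.
- by rewrite lee_fin !mulr_ge0 ?normal_pdf_ge0.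
(* After the exchange, the integral in x is that of a rescaled and shifted density, whose value 1 /
   |s / s2| cancels the Jacobian of the first substitution. *)
rewrite (@ge0_integral_affine R (s / s2) (- (s1 / s2 * v)) (EFin \o phi))//; last 3 first.
- by rewrite mulf_neq0 ?invr_neq0.
- exact/measurable_EFinP.
- by move=> x; rewrite lee_fin ?normal_pdf_ge0.
rewrite integral_normal_pdf mule1 -EFinM; congr EFin.
have e : \1_A (s * v) = \1_[set v : R | A (s * v)] v :> R.
  by rewrite !indicE; congr (nat_of_bool _)%:R.
by rewrite e; field; rewrite normr_eq0 mulf_neq0 ?invr_neq0.
Qed.

End normal_moments.

(** * Centered normal variables and their independent sums *)

Section centered_normal.
Context d (T : measurableType d) {R : realType} (P : probability T R).
Local Notation law := (has_centered_normal_law P).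
Local Notation N01 := (normal_prob (0 : R) 1).

Lemma centered_normal_lawN (s : R) (A : set R) :
  centered_normal_law (- s) A = centered_normal_law s A.
Proof.
rewrite /centered_normal_law oppr_eq0; case: eqVneq => [//|s0].
rewrite /normal_prob; apply: eq_integral => x _.
by rewrite !normal_pdfE ?oppr_eq0// /normal_fun /normal_peak sqrrN.
Qed.

Lemma has_centered_normal_lawN s X : law s X -> law (- s) X.
Proof. by move=> [mX hX]; split=> // A mA; rewrite centered_normal_lawN hX. Qed.

Lemma has_centered_normal_lawZ (c s : R) X : law s X -> law (c * s) (fun w => c * X w).
Proof.
move=> [mX hX]; split; first exact: measurable_funM.
move=> A mA; rewrite centered_normal_lawE//.
have mcA : measurable [set x | A (c * x)].
  rewrite -[X in measurable X]setTI.
  exact: (@measurable_funM _ _ _ _ (cst c) id).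
have := hX _ mcA; rewrite centered_normal_lawE//.
rewrite (_ : [set x | [set x | A (c * x)] (s * x)] = [set x | A (c * s * x)])//.
by apply/seteqP; split => x /=; rewrite mulrA.
Qed.

(** Used to pass from [B t \- B 0] to [B t], and from an explicit projection to the version chosen
    by [orth_proj]. Measurability of [Y] is required separately, almost sure equality alone not
    providing it. *)
Lemma ae_has_centered_normal_law s X Y : law s X -> measurable_fun setT Y ->
  X = Y %[ae P] -> law s Y.
Proof.
move=> [mX hX] mY XY; split => // A mA; rewrite -hX//.
have mXA : measurable (X @^-1` A) by rewrite -[X in measurable X]setTI; exact: mX.
have mYA : measurable (Y @^-1` A) by rewrite -[X in measurable X]setTI; exact: mY.
rewrite -[LHS]mul1e -[RHS]mul1e -!integral_cst//.
rewrite [LHS]integral_mkcond [RHS]integral_mkcond.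
apply: ge0_ae_eq_integral => //.
- by apply/(measurable_restrictT _ mYA); exact: measurable_cst.
- by apply/(measurable_restrictT _ mXA); exact: measurable_cst.
- by move=> w _; apply: erestrict_ge0.
- by move=> w _; apply: erestrict_ge0.
apply: filterS XY => w /(_ I) e _; rewrite !patchE.
rewrite (_ : (w \in _ @^-1` A) = (w \in X @^-1` A))//.
by apply/idP/idP => /set_mem /= H; apply/mem_set; rewrite /= ?e// -e.
Qed.

Lemma ge0_integral_centered_normal s X (f : R -> \bar R) : law s X ->
  measurable_fun setT f -> (forall x, 0 <= f x)%E ->
  (\int[P]_w f (X w) = \int[N01]_x f (s * x)%R)%E.
Proof.
move=> [mX hX] mf f0.
have ms : measurable_fun setT (fun x : measurableTypeR R => s * x : R).
  exact: measurable_funM.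
have := @ge0_integral_pushforward _ _ _ _ R X mX P setT f measurableT mf.
move=> /(_ (fun y _ => f0 y)); rewrite preimage_setT => <-.
have := @ge0_integral_pushforward _ _ _ _ R _ ms (normal_prob 0 1) setT f measurableT mf.
move=> /(_ (fun y _ => f0 y)); rewrite preimage_setT => <-.
apply: eq_measure_integral => A mA _.
by apply: (etrans (hX A mA)); exact: centered_normal_lawE.
Qed.

Lemma integral_sqr_centered_normal s X : law s X ->
  (\int[P]_w (X w ^+ 2)%:E = (s ^+ 2)%:E)%E.
Proof.
move=> hX; have m2 : measurable_fun setT (fun x : R => (x ^+ 2)%:E).
  by apply/measurable_EFinP; exact: exprn_measurable.
rewrite (ge0_integral_centered_normal hX m2); last first.
  by move=> x; rewrite lee_fin sqr_ge0.
under eq_integral do rewrite exprMn EFinM.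
rewrite ge0_integralZl//; last 2 first.
- by move=> x _; rewrite lee_fin sqr_ge0.
- by rewrite lee_fin sqr_ge0.
by rewrite integral_sqr_normal01 mule1.
Qed.

Lemma centered_normal_Lfun2 s X : law s X -> X \in Lfun P 2%:E.
Proof.
move=> hX; have [mX _] := hX.
rewrite inE/=; apply/andP; split; rewrite inE//=.
rewrite /finite_norm unlock/=.
apply: poweR_lty.
rewrite (_ : (\int[P]_x _)%E = (s ^+ 2)%:E) ?ltry//.
rewrite -(integral_sqr_centered_normal hX).
by apply: eq_integral => w _; rewrite /= powR_mulrn// -normrX ger0_norm ?sqr_ge0.
Qed.

Lemma Lfun2_Lfun1 X : X \in Lfun P 2%:E -> X \in Lfun P 1.
Proof. by apply: Lfun_subset12; exact: fin_num_measure. Qed.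

(** By symmetry: X and -X have the same law, so the mean, which is finite, equals its opposite. *)
Lemma expectation_centered_normal s X : law s X -> ('E_P[X] = 0)%E.
Proof.
move=> hX; have [mX hX'] := hX.
have X1 := Lfun2_Lfun1 (centered_normal_Lfun2 hX).
have hY := has_centered_normal_lawN (has_centered_normal_lawZ (-1) hX).
rewrite mulN1r opprK in hY; have [mY hY'] := hY.
have E : ('E_P[X] = 'E_P[fun w => (-1 * X w)%R])%E.
  rewrite unlock.
  have iX : P.-integrable setT (EFin \o X) by exact/Lfun1_integrable.
  have iY : P.-integrable setT (EFin \o (fun w => -1 * X w)).
    by apply/Lfun1_integrable/Lfun2_Lfun1; exact: centered_normal_Lfun2 hY.
  have := @integral_pushforward _ _ _ _ R X mX P setT EFin.
  rewrite preimage_setT => <-//.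
  have := @integral_pushforward _ _ _ _ R (fun w => -1 * X w) mY P setT EFin.
  rewrite preimage_setT => <-//.
  apply: eq_measure_integral => A mA _.
  exact: (etrans (hX' A mA) (esym (hY' A mA))).
move: E; have -> : (fun w => -1 * X w) = -1 \o* X by apply/funext => w /=; rewrite mulrC.
rewrite expectationZl//.
have := expectation_fin_num X1.
case: ('E_P[X]%E) => // r _ [] h; congr EFin; move: h; lra.
Qed.

End centered_normal.

Section sum.
Context d (T : measurableType d) {R : realType} (P : probability T R).
Local Notation law := (has_centered_normal_law P).
Local Notation N01 := (normal_prob (0 : R) 1).

(** The probability that X + Y lies in A is the integral over x of the probability that Y lies in A
    - x, which is a statement on N(0, 1) settled by rotation invariance. *)
Lemma has_centered_normal_lawD (s1 s2 : R) X Y : law s1 X -> law s2 Y ->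
  (forall A B, measurable A -> measurable B ->
    P (X @^-1` A `&` Y @^-1` B) = (P (X @^-1` A) * P (Y @^-1` B))%E) ->
  exists2 s, s ^+ 2 = s1 ^+ 2 + s2 ^+ 2 & law s (X \+ Y).
Proof.
move=> [mX hX] [mY hY] ind.
suff [s ss H] : exists2 s, s ^+ 2 = s1 ^+ 2 + s2 ^+ 2 &
    forall A : set R, measurable A ->
    (\int[N01]_x N01 [set y : R | A (s1 * x + s2 * y)%R] = N01 [set v : R | A (s * v)%R])%E.
  exists s => //; split; first exact: measurable_funD.
  move=> A mA; rewrite centered_normal_lawE// -H//.
  have mD : measurable_fun setT (fun z : R * R => z.1 + z.2) by exact: measurable_funD.
  have mS : measurable [set z : R * R | A (z.1 + z.2)].
    by rewrite -[X in measurable X]setTI; exact: mD.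
  have mXY : measurable_fun setT (fun w => (X w, Y w)) by exact/measurable_fun_pair.
  pose X' : {RV P >-> R} := HB.pack X (isMeasurableFun.Build _ _ _ _ _ mX).
  pose Y' : {RV P >-> R} := HB.pack Y (isMeasurableFun.Build _ _ _ _ _ mY).
  pose XY' : {RV P >-> (R * R)%type} :=
    HB.pack (fun w => (X w, Y w)) (isMeasurableFun.Build _ _ _ _ _ mXY).
  (* Independence is the product formula on measurable rectangles, which identifies the joint law
     with the product of the two laws. *)
  have := @product_measure_unique _ _ _ _ R (distribution P X') (distribution P Y')
    (distribution P XY') _ _ mS.
  rewrite [RHS in _ -> RHS]/= => h.
  transitivity (distribution P XY' [set z : R * R | A (z.1 + z.2)]) => //.
  rewrite -h; last first.
    move=> A' B' mA' mB'; rewrite /distribution /pushforward/= -ind//.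
  rewrite /product_measure1.
  have xS (x : R) : xsection [set z : R * R | A (z.1 + z.2)] x = [set y | A (x + y)].
    by apply/seteqP; split => y; rewrite /xsection/= inE.
  have mAx x : measurable [set y | A (x + y)] by rewrite -xS; exact: measurable_xsection.
  rewrite ge0_integral_pushforward//=; last first.
    exact: measurable_fun_xsection.
  rewrite (@ge0_integral_centered_normal _ _ _ P s1 X (distribution P Y' \o xsection [set z : R
      * R | A (z.1 + z.2)]))//; last first.
    exact: measurable_fun_xsection.
  apply: eq_integral => x _.
  by rewrite /= xS /distribution/= /pushforward hY// centered_normal_lawE.
(* The rotation argument divides by s2; for s2 = 0 the second variable is a point mass at 0 and s =
   s1 works. *)
have [s20|s20] := eqVneq s2 0.
  exists s1; first by rewrite s20 expr0n/= addr0.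
  move=> A mA.
  have mA' : measurable [set v : R | A (s1 * v)].
    rewrite -[X in measurable X]setTI.
    exact: (@measurable_funM _ _ _ _ (cst s1) id).
  rewrite -[RHS]mul1e -integral_cst//= [RHS]integral_mkcond; apply: eq_integral => x _.
  rewrite patchE; case: ifPn => [/set_mem Ax|Ax].
    rewrite (_ : [set y | _] = setT) ?probability_setT//.
    by apply/seteqP; split => // y _ /=; rewrite s20 mul0r addr0.
  rewrite (_ : [set y | _] = set0) ?measure0//.
  apply/seteqP; split => // y /=; rewrite s20 mul0r addr0 => /= Ax'.
  by move/negP: Ax; apply; exact/mem_set.
exists (Num.sqrt (s1 ^+ 2 + s2 ^+ 2)).
  by rewrite sqr_sqrtr// addr_ge0 ?sqr_ge0.
move=> A mA; apply: normal_prob01_rotation => //.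
by rewrite sqr_sqrtr// addr_ge0 ?sqr_ge0.
Qed.

End sum.

(** * Covariance and projection in L^2 *)

Section covariance_calculus.
Context d (T : measurableType d) {R : realType} (P : probability T R).
Implicit Types X Y Z : T -> R.
Local Notation L2 := (Lfun P 2%:E).

(** A real-valued covariance, so that bilinear identities are open to [ring] and [lra]; on L^2 no
    information is lost, by [covariance_rcov]. *)
Definition rcov X Y : R := fine (covariance P X Y).

Lemma Lfun2_mul X Y : X \in L2 -> Y \in L2 -> (X * Y)%R \in Lfun P 1.
Proof. exact: Lfun2_mul_Lfun1. Qed.

Lemma covariance_rcov X Y : X \in L2 -> Y \in L2 -> covariance P X Y = (rcov X Y)%:E.
Proof.
by move=> X2 Y2; rewrite fineK// covariance_fin_num ?Lfun2_mul ?Lfun2_Lfun1.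
Qed.

Lemma Lfun2D X Y : X \in L2 -> Y \in L2 -> X \+ Y \in L2.
Proof. by move=> X2 Y2; apply: rpredD; rewrite ?lee1n. Qed.

Lemma Lfun2Z c X : X \in L2 -> (fun w => c * X w) \in L2.
Proof.
move=> X2; rewrite (_ : (fun w => _) = c \o* X); first by apply: Lfun_scale => //; rewrite ler1n.
by apply/funext => w /=; rewrite mulrC.
Qed.

Lemma Lfun2B X Y : X \in L2 -> Y \in L2 -> X \- Y \in L2.
Proof.
move=> X2 Y2; rewrite (_ : X \- Y = X \+ (fun w => -1 * Y w)).
  by apply: Lfun2D => //; exact: Lfun2Z.
by apply/funext => w /=; rewrite mulN1r.
Qed.

Lemma rcovC X Y : rcov X Y = rcov Y X.
Proof. by rewrite /rcov covarianceC. Qed.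

Lemma rcovDl X Y Z : X \in L2 -> Y \in L2 -> Z \in L2 -> rcov (X \+ Y) Z = rcov X Z + rcov Y Z.
Proof.
by move=> X2 Y2 Z2; rewrite {1}/rcov covarianceDl// !covariance_rcov.
Qed.

Lemma rcovZl c X Y : X \in L2 -> Y \in L2 -> rcov (fun w => c * X w) Y = c * rcov X Y.
Proof.
move=> X2 Y2; rewrite (_ : (fun w => _) = c \o* X); last first.
  by apply/funext => w /=; rewrite mulrC.
by rewrite {1}/rcov covarianceZl ?Lfun2_mul ?Lfun2_Lfun1// covariance_rcov.
Qed.

Lemma rcovBl X Y Z : X \in L2 -> Y \in L2 -> Z \in L2 -> rcov (X \- Y) Z = rcov X Z - rcov Y Z.
Proof.
by move=> X2 Y2 Z2; rewrite {1}/rcov covarianceBl// !covariance_rcov.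
Qed.

Lemma rcovDr X Y Z : X \in L2 -> Y \in L2 -> Z \in L2 -> rcov X (Y \+ Z) = rcov X Y + rcov X Z.
Proof. by move=> X2 Y2 Z2; rewrite rcovC rcovDl// !(rcovC X). Qed.

Lemma rcovZr c X Y : X \in L2 -> Y \in L2 -> rcov X (fun w => c * Y w) = c * rcov X Y.
Proof. by move=> X2 Y2; rewrite rcovC rcovZl// rcovC. Qed.

Lemma rcovBr X Y Z : X \in L2 -> Y \in L2 -> Z \in L2 -> rcov X (Y \- Z) = rcov X Y - rcov X Z.
Proof. by move=> X2 Y2 Z2; rewrite rcovC rcovBl// !(rcovC X). Qed.

Lemma Lfun2_cst c : cst c \in L2. Proof. exact: Lfun_cst. Qed.

Lemma rcov_cst0r X : rcov X (cst 0) = 0.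
Proof. by rewrite /rcov covariance_cst_r. Qed.

Lemma Lfun2_sum n (c : 'I_n -> R) (X : 'I_n -> T -> R) : (forall i, X i \in L2) ->
  (fun w => \sum_(i < n) c i * X i w) \in L2.
Proof.
elim: n c X => [|n IH] c X hX.
  by rewrite (_ : (fun w => _) = cst 0) ?Lfun2_cst//; apply/funext => w; rewrite big_ord0.
rewrite (_ : (fun w => _) = (fun w => \sum_(i < n) c (widen_ord (leqnSn n) i) * X (widen_ord
    (leqnSn n) i) w)
   \+ (fun w => c ord_max * X ord_max w)).
  apply: Lfun2D; last exact: Lfun2Z.
  by apply: (IH (fun i => c _) (fun i => X _)) => i.
by apply/funext => w; rewrite big_ord_recr.
Qed.

Lemma rcov_sumr n (c : 'I_n -> R) (X : 'I_n -> T -> R) Y : (forall i, X i \in L2) ->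
  Y \in L2 -> rcov Y (fun w => \sum_(i < n) c i * X i w) = \sum_(i < n) c i * rcov Y (X i).
Proof.
elim: n c X => [|n IH] c X hX Y2.
  rewrite big_ord0 (_ : (fun w => _) = cst 0) ?rcov_cst0r//.
  by apply/funext => w; rewrite big_ord0.
rewrite (_ : (fun w => _) = (fun w => \sum_(i < n) c (widen_ord (leqnSn n) i) * X (widen_ord
    (leqnSn n) i) w)
   \+ (fun w => c ord_max * X ord_max w)); last first.
  by apply/funext => w; rewrite big_ord_recr.
have h := Lfun2_sum (fun i => c (widen_ord (leqnSn n) i)) (fun i => hX (widen_ord (leqnSn n) i)).
rewrite rcovDr ?Lfun2Z// rcovZr// big_ord_recr; congr (_ + _).
by apply: (IH (fun i => c _) (fun i => X _)).
Qed.

Lemma ae_expectation X Y : measurable_fun setT X -> measurable_fun setT Y ->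
  X = Y %[ae P] -> ('E_P[X] = 'E_P[Y])%E.
Proof.
move=> mX mY XY; rewrite unlock; apply: ae_eq_integral => //.
- exact/measurable_EFinP.
- exact/measurable_EFinP.
- by apply: filterS XY => w h _ /=; rewrite h.
Qed.

Lemma Lfun2_measurable X : X \in L2 -> measurable_fun setT X.
Proof. by rewrite inE/= => /andP[]; rewrite inE. Qed.

Lemma ae_covariance X Y Z : X \in L2 -> Y \in L2 -> Z \in L2 ->
  X = Y %[ae P] -> covariance P X Z = covariance P Y Z.
Proof.
move=> X2 Y2 Z2 XY.
have mX := Lfun2_measurable X2; have mY := Lfun2_measurable Y2.
have mZ := Lfun2_measurable Z2.
rewrite (covarianceE (Lfun2_Lfun1 X2) (Lfun2_Lfun1 Z2) (Lfun2_mul X2 Z2)).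
rewrite (covarianceE (Lfun2_Lfun1 Y2) (Lfun2_Lfun1 Z2) (Lfun2_mul Y2 Z2)).
rewrite (ae_expectation mX mY XY); congr (_ - _)%E.
apply: ae_expectation.
- exact: measurable_funM.
- exact: measurable_funM.
- by apply: filterS XY => w h _ /=; rewrite [LHS]/GRing.mul/= [RHS]/GRing.mul/= h.
Qed.

(** Restates the distance used in [closed_span] as a bound on a second moment, which then splits
    into variance and squared mean. *)
Lemma Lnorm2_sqr V : V \in L2 ->
  exists2 q, (\int[P]_w (V w ^+ 2)%:E = q%:E)%E &
    forall e, 0 < e -> ('N[P]_2%:E[EFin \o V] < e%:E)%E = (q < e ^+ 2).
Proof.
move=> V2; have := Lfun2_integrable_sqr V2.
move/(integrable_fin_num measurableT) => /= h.
exists (fine (\int[P]_w (V w ^+ 2)%:E)); first by rewrite fineK.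
move=> e e0; rewrite unlock/=.
rewrite (_ : (\int[P]_x _)%E = (\int[P]_w (V w ^+ 2)%:E)%E); last first.
  by apply: eq_integral => w _; rewrite /= powR_mulrn// -normrX ger0_norm ?sqr_ge0.
rewrite -{1}(fineK h) poweR_EFin lte_fin powR12_sqrt; last first.
  by apply: fine_ge0; apply: integral_ge0 => w _; rewrite lee_fin sqr_ge0.
rewrite -{1}(ger0_norm (ltW e0)) -sqrtr_sqr ltr_sqrt// exprn_gt0//.
Qed.

Lemma variance_expectation_sqr V q : V \in L2 -> (\int[P]_w (V w ^+ 2)%:E = q%:E)%E ->
  rcov V V + (fine 'E_P[V]) ^+ 2 = q.
Proof.
move=> V2 Vq; rewrite {1}/rcov covarianceE ?Lfun2_mul ?Lfun2_Lfun1//.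
have := expectation_fin_num (Lfun2_Lfun1 V2).
rewrite (_ : 'E_P[V * V]%E = q%:E); last first.
  by rewrite unlock -Vq; apply: eq_integral => w _; rewrite expr2.
by case: ('E_P[V]%E) => // r _ /=; rewrite subrK.
Qed.

Lemma rcov_ge0 V : 0 <= rcov V V.
Proof. by apply: fine_ge0; exact: variance_ge0. Qed.

Lemma rcov_eq0_ae V : V \in L2 -> ('E_P[V] = 0)%E -> rcov V V = 0 -> V = cst 0 %[ae P].
Proof.
move=> V2 V0 c0; have [q Vq _] := Lnorm2_sqr V2.
have := variance_expectation_sqr V2 Vq; rewrite c0 V0/= expr0n/= addr0 => q0.
have mV := Lfun2_measurable V2.
have m2 : measurable_fun setT (EFin \o (fun w => V w ^+ 2)).
  by apply/measurable_EFinP; exact: measurable_funX.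
have : (\int[P]_w `| (EFin \o (fun w => (V w ^+ 2)%R)) w | = 0)%E.
  transitivity q%:E; last by rewrite -q0.
  rewrite -Vq; apply: eq_integral => w _.
  by rewrite /= ger0_norm// sqr_ge0.
move/(ae_eq_integral_abs _ measurableT m2); apply: filterS => w /(_ I) /= [].
by move/eqP; rewrite sqrf_eq0 => /eqP.
Qed.

Lemma rcov_CS X Y : X \in L2 -> Y \in L2 -> (rcov X Y) ^+ 2 <= rcov X X * rcov Y Y.
Proof.
move=> X2 Y2; set a := rcov X X; set b := rcov X Y; set c := rcov Y Y.
have h (t : R) : 0 <= t ^+ 2 * a - 2 * t * b + c.
  have := rcov_ge0 ((fun w => t * X w) \- Y).
  rewrite rcovBl ?Lfun2B ?Lfun2Z// !rcovBr ?Lfun2Z//.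
  rewrite rcovZl ?Lfun2Z// !rcovZr// rcovZl// (rcovC Y X) -/a -/b -/c; lra.
have a0 : 0 <= a by exact: rcov_ge0.
have [a00|an0] := eqVneq a 0.
  have [b0|bn0] := eqVneq b 0; first by rewrite b0 expr0n/= a00 mul0r.
  (* When a = 0 the expression is affine in t, and this t brings it to -1, against its
     nonnegativity. *)
  have := h ((c + 1) / (2 * b)); rewrite a00 mulr0.
  have -> : 0 - 2 * ((c + 1) / (2 * b)) * b + c = -1 by field.
  by rewrite lerNr oppr0 ler10.
have := h (b / a).
have -> : (b / a) ^+ 2 * a - 2 * (b / a) * b + c = (a * c - b ^+ 2) / a by field.
by rewrite pmulr_lge0 ?subr_ge0// invr_gt0 lt_neqAle eq_sym an0.
Qed.

End covariance_calculus.

Section projection.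
Context d (T : measurableType d) {R : realType} (P : probability T R).
Implicit Types X Y Z : T -> R.
Local Notation L2 := (Lfun P 2%:E).
Variable S : set (T -> R).
Hypotheses (S2 : forall Z, S Z -> Z \in L2) (S0 : forall Z, S Z -> ('E_P[Z] = 0)%E).

Lemma linear_span_Lfun2 Z : linear_span S Z -> Z \in L2.
Proof. by move=> [n [c [X [SX ->]]]]; apply: Lfun2_sum => i; exact: S2. Qed.

Lemma expectation_linear_span Z : linear_span S Z -> ('E_P[Z] = 0)%E.
Proof.
move=> [n [c [X [SX ->]]]]; elim: n c X SX => [|n IH] c X SX.
  rewrite (_ : (fun w => _) = cst 0) ?expectation_cst//.
  by apply/funext => w; rewrite big_ord0.
rewrite (_ : (fun w => _) = (fun w => \sum_(i < n) c (widen_ord (leqnSn n) i) * X (widen_ord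
    (leqnSn n) i) w)
   \+ (c ord_max \o* X ord_max)); last first.
  by apply/funext => w; rewrite big_ord_recr/= [X ord_max w * _]mulrC.
have X1 i : X i \in Lfun P 1 by apply: Lfun2_Lfun1; exact: S2.
rewrite expectationD; last 2 first.
- by apply: Lfun2_Lfun1; apply: Lfun2_sum => i; exact: S2.
- exact: Lfun_scale.
rewrite expectationZl// (S0 (SX _)) mule0 adde0.
by apply: (IH (fun i => c _) (fun i => X _)).
Qed.

(** The second moment of the error [V] dominates both its variance and its squared mean. The
    variance serves for covariances, through Cauchy-Schwarz, and the mean for expectations. *)
Lemma closed_span_approx Z e : closed_span P S Z -> 0 < e ->
  exists V, [/\ V \in L2, linear_span S (Z \- V), rcov P V V < e ^+ 2 &
    (fine 'E_P[V]) ^+ 2 < e ^+ 2].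
Proof.
move=> [Z2 h] e0; have [W sW] := h e e0.
have W2 := linear_span_Lfun2 sW; have ZW2 := Lfun2B Z2 W2.
have [q Vq ->//] := Lnorm2_sqr ZW2; have := variance_expectation_sqr ZW2 Vq => E qe.
exists (Z \- W); split => //.
- by rewrite (_ : Z \- (Z \- W) = W)//; apply/funext => w /=; rewrite opprB addrC subrK.
- by apply: le_lt_trans qe; rewrite -E lerDl sqr_ge0.
- by apply: le_lt_trans qe; rewrite -E lerDr rcov_ge0.
Qed.

(** Covariance does not see constants, so orthogonality in covariance determines a projection almost
    surely only once the elements of the closed span are known to be centered. *)
Lemma expectation_closed_span Z : closed_span P S Z -> ('E_P[Z] = 0)%E.
Proof.
move=> sZ; have Z2 : Z \in L2 by case: sZ.
have h e : 0 < e -> (fine 'E_P[Z]) ^+ 2 < e ^+ 2.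
  move=> e0; have [V [V2 /expectation_linear_span ZV _]] := closed_span_approx sZ e0.
  move: ZV; rewrite expectationB ?Lfun2_Lfun1//.
  have := expectation_fin_num (Lfun2_Lfun1 Z2).
  have := expectation_fin_num (Lfun2_Lfun1 V2).
  case: ('E_P[V]%E) => // r _; case: ('E_P[Z]%E) => // z _ /= [] /eqP.
  by rewrite subr_eq0 => /eqP ->.
have := expectation_fin_num (Lfun2_Lfun1 Z2).
case: ('E_P[Z]%E) h => // z h _; congr EFin; apply/eqP/negP => /negP z0.
by have := h `|z|; rewrite normr_gt0 => /(_ z0) /=; rewrite real_normK ?num_real// ltxx.
Qed.

Variables X Y0 : T -> R.
Hypotheses (X2 : X \in L2) (SY0 : linear_span S Y0)
  (orth : forall Z, S Z -> rcov P (X \- Y0) Z = 0).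

Let Y02 : Y0 \in L2. Proof. exact: linear_span_Lfun2. Qed.
Let W2 : X \- Y0 \in L2. Proof. exact: Lfun2B. Qed.

Lemma orth_linear_span Z : linear_span S Z -> rcov P (X \- Y0) Z = 0.
Proof.
move=> [n [c [V [SV ->]]]]; rewrite rcov_sumr//; last by move=> i; exact: S2.
by rewrite big1// => i _; rewrite orth// mulr0.
Qed.

Lemma orth_closed_span Z : closed_span P S Z -> rcov P (X \- Y0) Z = 0.
Proof.
move=> sZ; have Z2 : Z \in L2 by case: sZ.
set W := X \- Y0; set a := rcov P W W; set b := rcov P W Z.
have a0 : 0 <= a by exact: rcov_ge0.
apply/eqP/negP => /negP b0.
have b2 : 0 < b ^+ 2 by rewrite exprn_even_gt0.
(* Chosen so that a e^2 < b^2, which contradicts Cauchy-Schwarz for W and the error V; a + 1 rather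
   than a because a may be 0. *)
pose e := Num.sqrt (b ^+ 2 / (a + 1)).
have e0 : 0 < e by rewrite sqrtr_gt0 divr_gt0// ltr_wpDl.
have ee : e ^+ 2 = b ^+ 2 / (a + 1) by rewrite sqr_sqrtr// ltW// divr_gt0// ltr_wpDl.
have [V [V2 ZV Ve _]] := closed_span_approx sZ e0.
have bE : b = rcov P W V.
  have := orth_linear_span ZV; rewrite rcovBr// => /eqP; rewrite subr_eq0 => /eqP //.
have := rcov_CS W2 V2; rewrite -/W -bE -/a.
apply/negP; rewrite -ltNge.
apply: (@le_lt_trans _ _ (a * e ^+ 2)); first by rewrite ler_wpM2l// ltW.
rewrite ee mulrCA -[ltRHS]mulr1 ltr_pM2l// ltr_pdivrMr ?mul1r ?ltrDl//.
by rewrite ltr_wpDl.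
Qed.

Lemma linear_closed_span : closed_span P S Y0.
Proof.
split => // e e0; exists Y0 => //.
rewrite (_ : EFin \o _ = cst 0%E); last by apply/funext => w /=; rewrite subrr.
by rewrite Lnorm0 ?lte_fin// gt_eqF// lte_fin.
Qed.

(** An element of the algebraic span that is orthogonal to the generators is already the projection
    on the closed span; any other version agrees with it almost surely. *)
Lemma orth_projP : orth_proj P (closed_span P S) X \in L2 /\
  orth_proj P (closed_span P S) X = Y0 %[ae P].
Proof.
set Y := orth_proj _ _ _.
have [sY oY] : closed_span P S Y /\
    forall Z, closed_span P S Z -> covariance P (X \- Y) Z = 0%E.
  (* The default [cst 0] of [xget] is ruled out because [Y0] itself is a candidate. *)
  rewrite /Y /orth_proj; case: xgetP => [Z -> //|h]; exfalso; apply: (h Y0).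
  split; first exact: linear_closed_span.
  move=> Z sZ; have Z2 : Z \in L2 by case: sZ.
  by rewrite covariance_rcov// orth_closed_span.
have Y2 : Y \in L2 by case: sY.
split => //.
have D2 : Y \- Y0 \in L2 by exact: Lfun2B.
have oD Z : closed_span P S Z -> rcov P (Y \- Y0) Z = 0.
  move=> sZ; have Z2 : Z \in L2 by case: sZ.
  have := orth_closed_span sZ; have : rcov P (X \- Y) Z = 0 by rewrite /rcov oY.
  rewrite !rcovBl//; lra.
(* Y - Y0 is centered and uncorrelated with Y and with Y0, hence has variance 0. Stability of the
   closed span under differences is not called upon. *)
have : Y \- Y0 = cst 0 %[ae P].
  apply: rcov_eq0_ae => //.
    rewrite expectationB ?Lfun2_Lfun1// expectation_closed_span//.
    by rewrite expectation_closed_span ?sube0//; exact: linear_closed_span.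
  by rewrite rcovBr// !oD ?subrr//; exact: linear_closed_span.
by apply: filterS => w /(_ I) /= /eqP; rewrite subr_eq0 => /eqP.
Qed.

End projection.

(** * Linear spans and the sigma-algebras they generate *)

Section linear_span.
Context d (T' : measurableType d) {R : realType}.
Implicit Types (S : set (T' -> R)).

Lemma linear_span_sub S X : S X -> linear_span S X.
Proof.
move=> SX; exists 1%N, (fun=> 1), (fun=> X); split => //.
by apply/funext => w; rewrite big_ord1 mul1r.
Qed.

Lemma linear_span0 S : linear_span S (cst 0).
Proof.
exists 0%N, (fun=> 0), (fun=> cst 0); split; first by case.
by apply/funext => w; rewrite big_ord0.
Qed.

Lemma linear_spanZ S c X : linear_span S X -> linear_span S (fun w => c * X w).
Proof.
move=> [n [b [Y [SY ->]]]]; exists n, (fun i => c * b i), Y; split => //.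
by apply/funext => w; rewrite mulr_sumr; apply: eq_bigr => i _; rewrite mulrA.
Qed.

Lemma linear_spanD S X Y : linear_span S X -> linear_span S Y -> linear_span S (X \+ Y).
Proof.
move=> [n [b [X' [SX' ->]]]] [m [c [Y' [SY' ->]]]].
exists (n + m)%N, (fun i => match fintype.split i with inl j => b j | inr j => c j end),
  (fun i => match fintype.split i with inl j => X' j | inr j => Y' j end).
split; first by move=> i; case: splitP.
apply/funext => w; rewrite /= big_split_ord/=; congr (_ + _); apply: eq_bigr => i _.
  by rewrite (unsplitK (inl i)).
by rewrite (unsplitK (inr i)).
Qed.

Lemma linear_spanS S S' X : S `<=` S' -> linear_span S X -> linear_span S' X.
Proof.
by move=> SS' [n [b [Y [SY ->]]]]; exists n, b, Y; split => // i; exact: SS'.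
Qed.

(** The list of pairs (coefficient, index) keeps the indices available, so that Brownian times can
    later be sorted. *)
Lemma linear_span_seq (I : Type) (D : set I) (X : I -> T' -> R) Z :
  linear_span [set X i | i in D] Z ->
  exists l : seq (R * I), (forall p, List.In p l -> D p.2) /\
    Z = (fun w => \sum_(p <- l) p.1 * X p.2 w).
Proof.
move=> [n [c [Y [SY ->]]]].
have /choice[f fP] : forall i, exists j, D j /\ X j = Y i.
  by move=> i; have [j Dj jE] := SY i; exists j.
exists [seq (c i, f i) | i <- enum 'I_n]; split.
  by move=> p /List.in_map_iff[i [<- _]]; have [] := fP i.
apply/funext => w; rewrite big_map big_enum/=; apply: eq_bigr => i _.
by have [_ ->] := fP i.
Qed.

(** Makes [independent], stated for families of events, applicable to linear combinations: with [G]
    taken as the measurable structure of the space, finite sums of measurable functions are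
    measurable. *)
Lemma linear_span_sigma (I : Type) (D : set I) (X : I -> T' -> R) (G : set (set T')) Z :
  sigma_algebra setT G -> sigma_of D X `<=` G ->
  linear_span [set X i | i in D] Z ->
  forall A : set R, measurable A -> G (Z @^-1` A).
Proof.
move=> sG XG [n [c [Y [SY ->]]]] A mA.
pose U := g_sigma_algebraType G.
have GE : <<s G >> = G by exact: sigma_algebra_id.
have mY i : measurable_fun [set: U] (Y i : U -> R).
  move=> _ B mB; have [j Dj <-] := SY i.
  apply: sub_sigma_algebra; apply: XG; apply: sub_sigma_algebra.
  by exists j => //; exists B.
have : measurable_fun [set: U] (fun w : U => \sum_(i < n) c i * Y i w).
  by apply: measurable_sum => i; exact: measurable_funM.
by move=> /(_ measurableT A mA); rewrite setTI /measurable/= GE.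
Qed.

End linear_span.

(** * Brownian motion *)

Section brownian.
Context d (T : measurableType d) {R : realType} (P : probability T R).
Local Notation law := (has_centered_normal_law P).
Variable B : R -> T -> R.
Hypothesis hB : brownian_motion P B.

Let span (s : R) := linear_span [set B u | u in [set u | 0 <= u <= s]].

Lemma sigma_of_sigma_algebra (I : Type) (D : set I) (X : I -> T -> R) :
  sigma_algebra setT (sigma_of D X).
Proof. exact: smallest_sigma_algebra. Qed.

Lemma has_centered_normal_law0 : law 0 (cst 0).
Proof.
split; first exact: measurable_cst.
move=> A mA; rewrite /centered_normal_law eqxx diracE.
case: (boolP (0 \in A)) => [/set_mem A0|A0].
  by rewrite (_ : _ @^-1` _ = setT) ?probability_setT//; apply/seteqP; split.
rewrite (_ : _ @^-1` _ = set0) ?measure0//.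
by apply/seteqP; split => // w /= /mem_set; rewrite (negbTE A0).
Qed.

Lemma brownian_law t : 0 <= t -> law (Num.sqrt t) (B t).
Proof.
move=> t0; have [h0 hinc _ hm _] := hB.
have := hinc 0 t (lexx _) t0; rewrite subr0 => h.
apply: (ae_has_centered_normal_law h); first exact: hm.
by apply: filterS h0 => w e _ /=; rewrite e subr0.
Qed.

(** Induction on the length, latest time first. With p the latest time and q the next, x B_p + y B_q
    = (x + y) B_q + x (B_p - B_q), and the increment is independent of everything up to time q. *)
Lemma brownian_sorted (l : seq (R * R)) : sorted (fun p q => q.2 <= p.2) l ->
  (forall p, p \in l -> 0 <= p.2) ->
  exists s, law s (fun w => \sum_(p <- l) p.1 * B p.2 w).
Proof.
have [h0 hinc hind hm _] := hB.
have [n] := ubnP (size l); elim: n l => // n IH [|p [|q r]]/= ln sl pos.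
- exists 0; rewrite (_ : (fun w => _) = cst 0); first exact: has_centered_normal_law0.
  by apply/funext => w; rewrite big_nil.
- exists (p.1 * Num.sqrt p.2).
  rewrite (_ : (fun w => _) = (fun w => p.1 * B p.2 w)); last first.
    by apply/funext => w; rewrite big_seq1.
  apply: has_centered_normal_lawZ; apply: brownian_law.
  by apply: pos; rewrite inE.
have /andP[qp pr] := sl.
have q0 : 0 <= q.2 by apply: pos; rewrite !inE eqxx orbT.
pose l' := (p.1 + q.1, q.2) :: r.
have [|||s2 h2] := IH l'.
- by rewrite /l'/= -ltnS.
- by rewrite /l'; case: (r) pr.
- move=> x; rewrite inE => /orP[/eqP ->//|xr].
  by apply: pos; rewrite !inE xr !orbT.
have h1 := has_centered_normal_lawZ p.1 (hinc q.2 p.2 q0 qp).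
(* All times of the merged list are at most q.2, so its sum belongs to the past of q.2. *)
have sl' : span q.2 (fun w => \sum_(p <- l') p.1 * B p.2 w).
  have : forall x, x \in l' -> 0 <= x.2 <= q.2.
    move=> x; rewrite inE => /orP[/eqP ->/=|xr]; first by rewrite q0 lexx.
    rewrite pos ?inE ?xr ?orbT//=.
    move: pr; rewrite path_sortedE; last by move=> a b c ab bc; exact: le_trans bc ab.
    by move=> /andP[/allP /(_ _ xr)].
  elim: (l') => [_|x k IHk hk].
    rewrite (_ : (fun w => _) = cst 0); first exact: linear_span0.
    by apply/funext => w; rewrite big_nil.
  rewrite (_ : (fun w => _) = (fun w => x.1 * B x.2 w) \+ (fun w => \sum_(p <- k) p.1 * B p.2 w)).
    apply: linear_spanD; last by apply: IHk => y yk; apply: hk; rewrite inE yk orbT.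
    apply: linear_spanZ; apply: linear_span_sub; exists x.2 => //.
    by apply: hk; rewrite inE eqxx.
  by apply/funext => w; rewrite big_cons.
have [|s _ hs] := has_centered_normal_lawD h2 h1.
- move=> A A' mA mA'; apply: (hind q.2 p.2 q0 qp).
    exact: (linear_span_sigma (@sigma_of_sigma_algebra _ _ _) (@subset_refl _ _) sl').
  pose X (u : R) := B u \- B q.2.
  apply: (@linear_span_sigma _ _ _ _ [set p.2] X _ _ (@sigma_of_sigma_algebra _ _ _)
      (@subset_refl _ _)) => //.
  by apply: linear_spanZ; apply: linear_span_sub; exists p.2.
exists s; rewrite (_ : (fun w => \sum_(p0 <- _) _) = (fun w => \sum_(p <- l') p.1 * B p.2 w) \+
    (fun w => p.1 * (B p.2 \- B q.2) w))//.
by apply/funext => w; rewrite /l' /= !big_cons/=; set S := \sum_(j <- r) _; ring.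
Qed.

Lemma brownian_span_gaussian Z : linear_span [set B t | t in [set t | 0 <= t]] Z ->
  exists s, law s Z.
Proof.
move=> /linear_span_seq[l [lD ->]].
pose l' := sort (fun p q : R * R => q.2 <= p.2) l.
have lS : perm_eq l' l by rewrite perm_sort.
have [||s hs] := @brownian_sorted l'.
- by apply: sort_sorted => x y; exact: le_total.
- move=> p; rewrite (perm_mem lS) => pl; apply: (lD p).
  by elim: (l) pl => // a k IH; rewrite inE => /orP[/eqP ->|/IH]; [left|right].
exists s; rewrite (_ : (fun w => _) = (fun w => \sum_(p <- l') p.1 * B p.2 w))//.
by apply/funext => w; apply: esym; exact: perm_big.
Qed.

Lemma brownian_Lfun2 t : 0 <= t -> B t \in Lfun P 2%:E.
Proof. by move=> t0; exact: centered_normal_Lfun2 (brownian_law t0). Qed.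

Lemma rcov_law s X : law s X -> rcov P X X = s ^+ 2.
Proof.
move=> h; have X2 := centered_normal_Lfun2 h.
have := variance_expectation_sqr X2 (integral_sqr_centered_normal h).
by rewrite (expectation_centered_normal h)/= expr0n/= addr0.
Qed.

(** Polarization: Var(X + Y) = Var X + Var Y + 2 Cov(X, Y). The variance supplied by
    [has_centered_normal_lawD] thus gives uncorrelatedness without computing the mean of a
    product. *)
Lemma rcov_law_indep s1 s2 s X Y : law s1 X -> law s2 Y -> law s (X \+ Y) ->
  s ^+ 2 = s1 ^+ 2 + s2 ^+ 2 -> rcov P X Y = 0.
Proof.
move=> h1 h2 h.
have X2 := centered_normal_Lfun2 h1; have Y2 := centered_normal_Lfun2 h2.
rewrite -(rcov_law h) -(rcov_law h1) -(rcov_law h2).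
rewrite rcovDl ?Lfun2D// !rcovDr// (rcovC _ Y X); lra.
Qed.

Lemma rcov_brownian s t : 0 <= s -> 0 <= t -> rcov P (B s) (B t) = Num.min s t.
Proof.
wlog st : s t / s <= t => [h s0 t0|s0 t0].
  by have /orP[st|ts] := le_total s t; [|rewrite rcovC minC]; exact: h.
have [_ hinc _ _ _] := hB.
have := rcov_law (hinc s t s0 st); have := rcov_law (brownian_law s0).
have := rcov_law (brownian_law t0).
have Bs := brownian_Lfun2 s0; have Bt := brownian_Lfun2 t0.
rewrite rcovBl ?Lfun2B// !rcovBr// (rcovC _ (B t)) !sqr_sqrtr ?subr_ge0// min_l//; lra.
Qed.

End brownian.

(** * Integrals of the logarithmic kernel *)

Section log_kernel.
Context {R : realType}.
Implicit Types (rho psi theta phi : R).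
Local Notation mu := (@lebesgue_measure R).

(* |1 - rho e^(i psi)|^2 *)
Definition dist2 rho psi : R := 1 + rho ^+ 2 - 2 * rho * cos psi.

(* For rho = 1 and theta = phi the division by 0 gives the value 0, which is
   also the junk value of [gff_kernel] on the diagonal. *)
Definition log_kernel rho theta phi : R :=
  ln (dist2 rho (theta + phi) / dist2 rho (theta - phi)).

Lemma dist2N rho psi : dist2 rho (- psi) = dist2 rho psi.
Proof. by rewrite /dist2 cosN. Qed.

Lemma dist2_ge0 rho psi : 0 <= rho -> 0 <= dist2 rho psi.
Proof.
move=> r0; have := cos_le1 psi => c1.
rewrite /dist2; have := sqr_ge0 (1 - rho); nra.
Qed.

Lemma dist2_gt0 rho psi : 0 < rho < 1 -> 0 < dist2 rho psi.
Proof.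
move=> /andP[r0 r1]; have := cos_le1 psi => c1.
rewrite /dist2; nra.
Qed.

Lemma dist2_gt0_cos rho psi : 0 < rho -> cos psi < 1 -> 0 < dist2 rho psi.
Proof. by move=> r0 c1; rewrite /dist2; have := sqr_ge0 (1 - rho); nra. Qed.

Lemma dist2B rho theta phi :
  dist2 rho (theta + phi) - dist2 rho (theta - phi) = 4 * rho * sin theta * sin phi.
Proof. by rewrite /dist2 cosD cosB; ring. Qed.

(* psi - 2 arg (1 - rho e^(i psi)), a primitive of the Poisson kernel *)
Definition dist2_arg rho psi : R := psi + 2 * atan (rho * sin psi / (1 - rho * cos psi)).

Lemma den_gt0 rho psi : 0 < rho < 1 -> 0 < 1 - rho * cos psi.
Proof. move=> /andP[r0 r1]; have := cos_le1 psi => c1; nra. Qed.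

Lemma is_derive_dist2 rho psi : is_derive psi (1 : R) (dist2 rho) (2 * rho * sin psi).
Proof.
rewrite /dist2; apply: is_derive_eq; rewrite /GRing.scale/=; ring.
Qed.

Lemma is_derive_ln_dist2 rho psi : 0 < rho < 1 ->
  is_derive psi (1 : R) (fun x => ln (dist2 rho x)) (2 * rho * sin psi / dist2 rho psi).
Proof.
move=> r; have d := is_derive_dist2 rho psi.
have dl := is_derive1_ln (dist2_gt0 psi r).
have := @is_derive1_comp _ (@ln R) (dist2 rho) psi _ _ dl d.
by rewrite mulrC.
Qed.

Lemma is_derive_dist2_arg rho psi : 0 < rho < 1 ->
  is_derive psi (1 : R) (dist2_arg rho) ((1 - rho ^+ 2) / dist2 rho psi).
Proof.
move=> r; have r1 := den_gt0 psi r; have r2 := dist2_gt0 psi r.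
have n1 : 1 - rho * cos psi != 0 by exact: lt0r_neq0.
have n2 : dist2 rho psi != 0 by exact: lt0r_neq0.
rewrite /dist2_arg.
have dden : is_derive psi (1 : R) (fun x => (1 - rho * cos x)^-1)
   (- (rho * sin psi) / (1 - rho * cos psi) ^+ 2).
  have dd : is_derive psi (1 : R) (fun x => 1 - rho * cos x) (rho * sin psi).
    by apply: is_derive_eq; rewrite /GRing.scale/=; ring.
  apply: is_derive_eq; rewrite /GRing.scale/=; field; exact: n1.
have dq : is_derive psi (1 : R) (fun x => rho * sin x / (1 - rho * cos x))
   ((rho * cos psi - rho ^+ 2) / (1 - rho * cos psi) ^+ 2).
  apply: is_derive_eq; rewrite /GRing.scale/=.
  have s2 := sin2cos2 psi.
  apply/eqP; rewrite -subr_eq0; apply/eqP.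
  (* [field] does not know sin^2 + cos^2 = 1, so the difference is exhibited as an explicit multiple
     of 1 - cos^2 - sin^2. The derivatives of the cosine primitives are checked by the same
     device. *)
  transitivity (rho ^+ 2 * (1 - cos psi ^+ 2 - sin psi ^+ 2) / (1 - rho * cos psi) ^+ 2).
    by field; exact: n1.
  by rewrite s2 subrr mulr0 mul0r.
have da := @is_derive1_comp _ (@atan R) (fun x => rho * sin x / (1 - rho * cos x)) psi _ _
    (is_derive1_atan _) dq.
apply: is_derive_eq; rewrite /GRing.scale/=.
have e : 1 + (rho * sin psi / (1 - rho * cos psi)) ^+ 2 = dist2 rho psi / (1 - rho * cos psi) ^+ 2.
  rewrite exprMn exprMn sin2cos2 /dist2; field; exact: n1.
rewrite e /dist2; move: n2; rewrite /dist2 => n2; field; rewrite n1 n2//.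
Qed.

(* The [prim_ln_] functions are primitives of ln dist2 times sin, cos, sin 2psi,
   cos 2psi. In the variable u = dist2 rho psi one has du = 2 rho sin psi dpsi and
   cos psi = (1 + rho^2 - u) / (2 rho), which handles the sines; for the cosines,
   integrate by parts and divide sin^2 by dist2. *)
Definition prim_ln_sin1 rho psi : R :=
  (dist2 rho psi * ln (dist2 rho psi) - dist2 rho psi) / (2 * rho).

Definition prim_ln_cos1 rho psi : R := sin psi * ln (dist2 rho psi) - sin psi
  - (1 + rho ^+ 2) / (2 * rho) * psi + (1 - rho ^+ 2) / (2 * rho) * dist2_arg rho psi.

Definition prim_ln_sin2 rho psi : R := (2 * rho ^+ 2)^-1 *
  ((1 + rho ^+ 2) * (dist2 rho psi * ln (dist2 rho psi) - dist2 rho psi)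
   - (dist2 rho psi ^+ 2 / 2 * ln (dist2 rho psi) - dist2 rho psi ^+ 2 / 4)).

Definition prim_ln_cos2 rho psi : R := 2^-1 * (2 * sin psi * cos psi * ln (dist2 rho psi)
  - (psi + sin psi * cos psi + (1 + rho ^+ 2) / rho * sin psi
     - (1 - rho ^+ 2) * (1 + rho ^+ 2) / (2 * rho ^+ 2) * dist2_arg rho psi
     + (1 - rho ^+ 2) ^+ 2 / (2 * rho ^+ 2) * psi)).

Lemma is_derive_prim_ln_sin1 rho psi : 0 < rho < 1 ->
  is_derive psi (1 : R) (prim_ln_sin1 rho) (ln (dist2 rho psi) * sin psi).
Proof.
move=> r; have d := is_derive_dist2 rho psi; have dl := is_derive_ln_dist2 psi r.
have n2 : dist2 rho psi != 0 by apply/lt0r_neq0/dist2_gt0.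
have n0 : rho != 0 by case/andP: r => /lt0r_neq0.
rewrite /prim_ln_sin1; apply: is_derive_eq; rewrite /GRing.scale/=; field.
by rewrite n0 n2.
Qed.

Lemma is_derive_prim_ln_cos1 rho psi : 0 < rho < 1 ->
  is_derive psi (1 : R) (prim_ln_cos1 rho) (ln (dist2 rho psi) * cos psi).
Proof.
move=> r; have d := is_derive_dist2 rho psi; have dl := is_derive_ln_dist2 psi r.
have dA := is_derive_dist2_arg psi r.
have n2 : dist2 rho psi != 0 by apply/lt0r_neq0/dist2_gt0.
have n0 : rho != 0 by case/andP: r => /lt0r_neq0.
rewrite /prim_ln_cos1; apply: is_derive_eq; rewrite /GRing.scale/=.
apply/eqP; rewrite -subr_eq0; apply/eqP.
set L := ln _; have s2 := sin2cos2 psi.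
transitivity (2 * rho * (sin psi ^+ 2 - (1 - cos psi ^+ 2)) / dist2 rho psi).
  by move: n2; rewrite /dist2 => n2; field; rewrite n0 n2.
by rewrite s2 subrr mulr0 mul0r.
Qed.

Lemma is_derive_prim_ln_sin2 rho psi : 0 < rho < 1 ->
  is_derive psi (1 : R) (prim_ln_sin2 rho) (ln (dist2 rho psi) * (2 * sin psi * cos psi)).
Proof.
move=> r; have d := is_derive_dist2 rho psi; have dl := is_derive_ln_dist2 psi r.
have n2 : dist2 rho psi != 0 by apply/lt0r_neq0/dist2_gt0.
have n0 : rho != 0 by case/andP: r => /lt0r_neq0.
rewrite /prim_ln_sin2; apply: is_derive_eq; rewrite /GRing.scale/=.
set L := ln _.
by move: n2; rewrite /dist2 => n2; field; rewrite n0 n2.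
Qed.

Lemma is_derive_prim_ln_cos2 rho psi : 0 < rho < 1 ->
  is_derive psi (1 : R) (prim_ln_cos2 rho) (ln (dist2 rho psi) * (cos psi ^+ 2 - sin psi ^+ 2)).
Proof.
move=> r; have d := is_derive_dist2 rho psi; have dl := is_derive_ln_dist2 psi r.
have dA := is_derive_dist2_arg psi r.
have n2 : dist2 rho psi != 0 by apply/lt0r_neq0/dist2_gt0.
have n0 : rho != 0 by case/andP: r => /lt0r_neq0.
rewrite /prim_ln_cos2; apply: is_derive_eq; rewrite /GRing.scale/=.
apply/eqP; rewrite -subr_eq0; apply/eqP.
set L := ln _; have s2 := sin2cos2 psi.
transitivity ((2 * rho * cos psi / dist2 rho psi + 2^-1) * (sin psi ^+ 2 - (1 - cos psi ^+ 2))).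
  by move: n2; rewrite /dist2 => n2; field; rewrite n0 n2.
by rewrite s2 subrr mulr0.
Qed.

Lemma log_kernelE rho theta phi : 0 < rho < 1 ->
  log_kernel rho theta phi = ln (dist2 rho (theta + phi)) - ln (dist2 rho (theta - phi)).
Proof. by move=> r; rewrite /log_kernel ln_div// posrE dist2_gt0. Qed.

Lemma is_derive1_shift (F : R -> R) (f c x : R) : is_derive (x + c) (1 : R) F f ->
  is_derive x (1 : R) (fun y => F (y + c)) f.
Proof.
move=> dF; have ds : is_derive x (1 : R) (fun y => y + c) 1.
  by apply: is_derive_eq; rewrite addr0.
have := @is_derive1_comp _ F (fun y => y + c) x _ _ dF ds.
by rewrite mulr1.
Qed.

(** Comes from writing phi = (phi + theta) - theta in the first logarithm and phi = (phi - theta) +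
    theta in the second, then expanding sin phi by the addition formulas. *)
Definition prim_log_kernel1 rho theta phi : R := cos theta * prim_ln_sin1 rho (phi + theta)
  - sin theta * prim_ln_cos1 rho (phi + theta)
  - cos theta * prim_ln_sin1 rho (phi - theta) - sin theta * prim_ln_cos1 rho (phi - theta).

Lemma is_derive_prim_log_kernel1 rho theta phi : 0 < rho < 1 ->
  is_derive phi (1 : R) (prim_log_kernel1 rho theta) (log_kernel rho theta phi * sin phi).
Proof.
move=> r.
have d1 := is_derive1_shift (is_derive_prim_ln_sin1 (phi + theta) r).
have d2 := is_derive1_shift (is_derive_prim_ln_cos1 (phi + theta) r).
have d3 := is_derive1_shift (is_derive_prim_ln_sin1 (phi - theta) r).
have d4 := is_derive1_shift (is_derive_prim_ln_cos1 (phi - theta) r).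
rewrite /prim_log_kernel1; apply: is_derive_eq; rewrite /GRing.scale/=.
rewrite log_kernelE// -(dist2N _ (theta - phi)) opprB (addrC theta phi).
set La := ln _; set Lb := ln (dist2 _ (phi - theta)).
have -> : (La - Lb) * sin phi = La * sin (phi + theta - theta) - Lb * sin (phi - theta + theta).
  by rewrite addrK subrK; ring.
rewrite (sinB (phi + theta)) (sinD (phi - theta)); ring.
Qed.

(** The same shifts applied to sin (2 phi); the coefficients are cos (2 theta) and sin (2 theta)
    written out. *)
Definition prim_log_kernel2 rho theta phi : R :=
  (cos theta ^+ 2 - sin theta ^+ 2) * prim_ln_sin2 rho (phi + theta)
  - 2 * sin theta * cos theta * prim_ln_cos2 rho (phi + theta)
  - (cos theta ^+ 2 - sin theta ^+ 2) * prim_ln_sin2 rho (phi - theta)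
  - 2 * sin theta * cos theta * prim_ln_cos2 rho (phi - theta).

Lemma is_derive_prim_log_kernel2 rho theta phi : 0 < rho < 1 ->
  is_derive phi (1 : R) (prim_log_kernel2 rho theta) (log_kernel rho theta phi * (2 * sin phi *
      cos phi)).
Proof.
move=> r.
have d1 := is_derive1_shift (is_derive_prim_ln_sin2 (phi + theta) r).
have d2 := is_derive1_shift (is_derive_prim_ln_cos2 (phi + theta) r).
have d3 := is_derive1_shift (is_derive_prim_ln_sin2 (phi - theta) r).
have d4 := is_derive1_shift (is_derive_prim_ln_cos2 (phi - theta) r).
rewrite /prim_log_kernel2; apply: is_derive_eq; rewrite /GRing.scale/=.
rewrite log_kernelE// -(dist2N _ (theta - phi)) opprB (addrC theta phi).
set La := ln _; set Lb := ln (dist2 _ (phi - theta)).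
have -> : (La - Lb) * (2 * sin phi * cos phi) =
  La * (2 * sin (phi + theta - theta) * cos (phi + theta - theta))
  - Lb * (2 * sin (phi - theta + theta) * cos (phi - theta + theta)).
  by rewrite addrK subrK; ring.
rewrite (sinB (phi + theta)) (cosB (phi + theta)) (sinD (phi - theta)) (cosD (phi - theta)); ring.
Qed.

(** At each end point the logarithms and arctangents of the two shifts cancel by parity and
    periodicity. What is left comes from the part of [prim_ln_cos1] linear in psi, of slope - (1 +
    rho^2) / (2 rho) + (1 - rho^2) / (2 rho) = - rho. *)
Lemma prim_log_kernel1_pi0 rho theta : 0 < rho < 1 ->
  prim_log_kernel1 rho theta pi - prim_log_kernel1 rho theta 0 = 2 * pi * rho * sin theta.
Proof.
move=> r; have n0 : rho != 0 by case/andP: r => /lt0r_neq0.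
rewrite /prim_log_kernel1 /prim_ln_sin1 /prim_ln_cos1 /dist2_arg !add0r !dist2N !(addrC pi)
    !cosN !sinN.
have -> : dist2 rho (- theta + pi) = dist2 rho (theta + pi).
  by rewrite /dist2 !cosDpi cosN.
rewrite !sinDpi !cosDpi !cosN !sinN !opprK.
rewrite !mulrN !mulNr !atanN !opprK.
set L1 := ln _; set L2 := ln _; set a1 := atan _; set a2 := atan _.
field; exact: n0.
Qed.

(** Same cancellations; here the linear part of [prim_ln_cos2] has slope - rho^2 / 2. *)
Lemma prim_log_kernel2_pi0 rho theta : 0 < rho < 1 ->
  prim_log_kernel2 rho theta pi - prim_log_kernel2 rho theta 0 = pi * rho ^+ 2 * (2 * sin theta
      * cos theta).
Proof.
move=> r; have n0 : rho != 0 by case/andP: r => /lt0r_neq0.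
rewrite /prim_log_kernel2 /prim_ln_sin2 /prim_ln_cos2 /dist2_arg !add0r !dist2N !(addrC pi)
    !cosN !sinN.
have -> : dist2 rho (- theta + pi) = dist2 rho (theta + pi).
  by rewrite /dist2 !cosDpi cosN.
rewrite !sinDpi !cosDpi !cosN !sinN !opprK.
rewrite !mulrN !mulNr !atanN !opprK.
set L1 := ln _; set L2 := ln _; set a1 := atan _; set a2 := atan _.
field; exact: n0.
Qed.

End log_kernel.

(** * Integrals against sin phi and sin (2 phi), up to rho = 1 *)

Section log_kernel_integrals.
Context {R : realType}.
Implicit Types (rho psi theta phi : R).
Local Notation mu := (@lebesgue_measure R).
Local Notation D := (`]0, pi[%classic : set R).

Lemma measurable_D : measurable D. Proof. exact: measurable_itv. Qed.

Lemma measurable_dist2 d (T : measurableType d) rho (f : T -> R) :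
  measurable_fun setT f -> measurable_fun setT (fun x => dist2 rho (f x)).
Proof.
move=> mf; apply: measurable_funB; first exact: measurable_cst.
apply: measurable_funM; first exact: measurable_cst.
apply: measurableT_comp mf.
by apply: continuous_measurable_fun; exact: continuous_cos.
Qed.

Lemma measurable_log_kernel rho : 0 < rho ->
  measurable_fun setT (fun z : R * R => log_kernel rho z.1 z.2).
Proof.
move=> r0.
pose vp (z : R * R) := dist2 rho (z.1 + z.2).
pose vm (z : R * R) := dist2 rho (z.1 - z.2).
have mp : measurable_fun setT vp by apply: measurable_dist2; exact: measurable_funD.
have mm : measurable_fun setT vm by apply: measurable_dist2; exact: measurable_funB.
(* The test trades the quotient for a difference of logarithms: if one of the two distances
   vanishes, the quotient is 0 and [ln] takes its default value 0. *)
rewrite (_ : (fun _ => _) = (fun z => if 0 < vp z * vm z then ln (vp z) - ln (vm z) else 0)).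
  apply: measurable_fun_ifT.
  - by apply: measurable_fun_ltr => //; exact: measurable_funM.
  - by apply: measurable_funB; apply: measurableT_comp => //; exact: measurable_ln.
  - exact: measurable_cst.
apply/funext => z; rewrite /log_kernel -/(vp z) -/(vm z).
have p0 : 0 <= vp z by apply: dist2_ge0; exact: ltW.
have m0 : 0 <= vm z by apply: dist2_ge0; exact: ltW.
move: p0; rewrite le_eqVlt => /orP[/eqP <-|p0].
  by rewrite !mul0r ltxx ln0.
move: m0; rewrite le_eqVlt => /orP[/eqP <-|m0].
  by rewrite invr0 !mulr0 ltxx ln0.
by rewrite mulr_gt0// ln_div.
Qed.

Lemma measurable_log_kernel2 rho theta : 0 < rho ->
  measurable_fun setT (log_kernel rho theta).
Proof.
move=> r0; apply: (measurableT_comp (measurable_log_kernel r0)) (_ : measurable_fun _ (fun y =>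
    (theta, y))).
by apply: measurable_fun_pair.
Qed.

Lemma cos_lt1 theta phi : D theta -> D phi -> theta != phi -> cos (theta - phi) < 1.
Proof.
wlog tp : theta phi / phi < theta => [h Dt Dp tp|].
  have [pt|tp'|e] := ltgtP phi theta; first exact: h.
    by rewrite -cosN opprB; apply: h => //; rewrite eq_sym.
  by move: tp; rewrite e eqxx.
rewrite /= !in_itv/= => /andP[t0 tpi] /andP[p0 ppi] _.
rewrite -cos0 ltr_cos ?subr_gt0// in_itv/= ?lexx ?pi_ge0//.
by apply/andP; split; lra.
Qed.

Lemma sin_gt0 theta : D theta -> 0 < sin theta.
Proof. by rewrite /= in_itv/=; exact: sin_gt0_pi. Qed.

(** In this form the ratio is visibly at least 1 for angles in (0, pi), and it depends on rho only
    through rho / [dist2 rho (theta - phi)]; sign and monotonicity of [log_kernel] follow. *)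
Lemma dist2_ratio rho theta phi : dist2 rho (theta - phi) != 0 ->
  dist2 rho (theta + phi) / dist2 rho (theta - phi) =
  1 + 4 * sin theta * sin phi * (rho / dist2 rho (theta - phi)).
Proof.
move=> v0; have := dist2B rho theta phi => /eqP; rewrite subr_eq => /eqP ->.
by field.
Qed.

Lemma log_kernel_ge0 rho theta phi : 0 < rho -> D theta -> D phi ->
  0 <= log_kernel rho theta phi.
Proof.
move=> r0 Dt Dp; rewrite /log_kernel.
have [->|v0] := eqVneq (dist2 rho (theta - phi)) 0; first by rewrite invr0 mulr0 ln0.
rewrite dist2_ratio// ln_ge0// lerDl.
have s1 := sin_gt0 Dt; have s2 := sin_gt0 Dp.
by rewrite !mulr_ge0 ?invr_ge0 ?dist2_ge0// ltW.
Qed.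

(** Monotonicity would fail on the diagonal at rho' = 1, where [log_kernel] has the default value 0
    instead of being infinite. *)
Lemma log_kernel_le rho rho' theta phi : 0 < rho -> rho <= rho' -> rho' <= 1 ->
  D theta -> D phi -> theta != phi ->
  log_kernel rho theta phi <= log_kernel rho' theta phi.
Proof.
move=> r0 rr r1 Dt Dp tp; have c1 := cos_lt1 Dt Dp tp.
have r0' := lt_le_trans r0 rr.
have v := dist2_gt0_cos r0 c1; have v' := dist2_gt0_cos r0' c1.
have s1 := sin_gt0 Dt; have s2 := sin_gt0 Dp.
have ss : 0 < 4 * sin theta * sin phi by rewrite !mulr_gt0.
rewrite /log_kernel !dist2_ratio ?lt0r_neq0// ler_ln ?posrE; last 2 first.
- by rewrite ltr_pwDl// ltW// !mulr_gt0// invr_gt0.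
- by rewrite ltr_pwDl// ltW// !mulr_gt0// invr_gt0.
rewrite lerD2l ler_pM2l// ler_pdivrMr// mulrAC ler_pdivlMr//.
have rr1 : rho * rho' <= 1 by nra.
(* After cross multiplication the terms in cos (theta - phi) cancel, and both remaining factors are
   nonnegative. *)
rewrite -subr_ge0 (_ : _ - _ = (rho' - rho) * (1 - rho * rho')).
  by rewrite mulr_ge0// subr_ge0.
by rewrite /dist2; ring.
Qed.

Lemma continuous_log_kernel rho theta : 0 < rho < 1 ->
  continuous (log_kernel rho theta).
Proof.
move=> r; rewrite (_ : log_kernel rho theta =
  (fun phi => ln (dist2 rho (phi + theta)) - ln (dist2 rho (phi - theta)))); last first.
  by apply/funext => phi; rewrite log_kernelE// (addrC phi) -(dist2N _ (theta - phi)) opprB.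
suff dK (x : R) : derivable (fun phi => ln (dist2 rho (phi + theta)) - ln (dist2 rho (phi -
    theta))) x (1 : R).
  by move=> x; apply: differentiable_continuous; apply/derivable1_diffP; exact: dK.
have d1 := @is_derive1_shift _ _ _ theta x (is_derive_ln_dist2 (x + theta) r).
have d2 := @is_derive1_shift _ _ _ (- theta) x (is_derive_ln_dist2 (x - theta) r).
by apply: derivableB.
Qed.

Lemma integral_log_kernel_sin_lt1 rho theta : 0 < rho < 1 ->
  (\int[mu]_(phi in D) (log_kernel rho theta phi * sin phi)%:E =
   (2 * pi * rho * sin theta)%:E)%E.
Proof.
move=> r.
have c : continuous (fun phi => log_kernel rho theta phi * sin phi).
  by move=> x; apply: cvgM; [exact: continuous_log_kernel|exact: continuous_sin].
rewrite -(integral_itv_bndoo true false); last first.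
  apply: measurable_funTS; apply/measurable_EFinP; exact: continuous_measurable_fun.
rewrite (integral_itv_is_derive (pi_gt0 R) (fun x => is_derive_prim_log_kernel1 theta x r) c).
by rewrite prim_log_kernel1_pi0.
Qed.

Lemma integral_log_kernel_sin2_lt1 rho theta : 0 < rho < 1 ->
  (\int[mu]_(phi in D) (log_kernel rho theta phi * (2 * sin phi * cos phi))%:E =
   (pi * rho ^+ 2 * (2 * sin theta * cos theta))%:E)%E.
Proof.
move=> r.
have c : continuous (fun phi => log_kernel rho theta phi * (2 * sin phi * cos phi)).
  move=> x; apply: cvgM; first exact: continuous_log_kernel.
  apply: cvgM; last exact: continuous_cos.
  by apply: cvgM; [exact: cvg_cst|exact: continuous_sin].
rewrite -(integral_itv_bndoo true false); last first.
  apply: measurable_funTS; apply/measurable_EFinP; exact: continuous_measurable_fun.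
rewrite (integral_itv_is_derive (pi_gt0 R) (fun x => is_derive_prim_log_kernel2 theta x r) c).
by rewrite prim_log_kernel2_pi0.
Qed.

(* The value rho = 1 is reached along r_ n, increasing to 1, off the diagonal,
   where log_kernel is nondecreasing and continuous in rho. *)
Let r_ (n : nat) : R := 1 - harmonic n.+1.

Let r_itv n : 0 < r_ n < 1.
Proof.
rewrite /r_ /harmonic/=; apply/andP; split; last by rewrite ltrBlDr ltrDl invr_gt0.
by rewrite subr_gt0 invf_lt1// ltr1n.
Qed.

Let r_nd m n : (m <= n)%N -> r_ m <= r_ n.
Proof. by move=> mn; rewrite /r_ /harmonic/= lerD2l lerN2 lef_pV2 ?posrE// ler_nat !ltnS. Qed.

Let r_cvg : r_ n @[n --> \oo] --> (1 : R).
Proof.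
rewrite -[X in _ --> X]subr0; apply: cvgB; first exact: cvg_cst.
by have := @cvg_harmonic R; rewrite -cvg_shiftS.
Qed.

Let Dt theta := D `\ theta.

Let mDt theta : measurable (Dt theta).
Proof. by apply: measurableD => //; exact: measurable_itv. Qed.

Let cvg_log_kernel theta phi : D theta -> Dt theta phi ->
  log_kernel (r_ n) theta phi @[n --> \oo] --> log_kernel 1 theta phi.
Proof.
move=> Dth [Dp /= tp].
have c1 : cos (theta - phi) < 1 by apply: cos_lt1 => //; apply/eqP => e; exact: tp.
have v0 := dist2_gt0_cos ltr01 c1.
have cd psi : dist2 (r_ n) psi @[n --> \oo] --> dist2 1 psi.
  rewrite /dist2; apply: cvgB.
    by apply: cvgD; [exact: cvg_cst|rewrite !expr2; apply: cvgM; exact: r_cvg].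
  by apply: cvgM; [apply: cvgM; [exact: cvg_cst|exact: r_cvg]|exact: cvg_cst].
apply: continuous_cvg.
  apply: continuous_ln; rewrite dist2_ratio ?lt0r_neq0// ltr_pwDl//.
  by rewrite !mulr_ge0 ?invr_ge0 ?(ltW v0)// ltW// sin_gt0.
apply: cvgM; first exact: cd.
by apply: cvgV; [exact: lt0r_neq0|exact: cd].
Qed.

Let integral_Dt theta (f : R -> R) : measurable_fun setT f ->
  (\int[mu]_(phi in Dt theta) (f phi)%:E = \int[mu]_(phi in D) (f phi)%:E)%E.
Proof.
move=> mf; apply: integral_setD1; first exact: mDt.
by apply: measurable_funTS; exact/measurable_EFinP.
Qed.

Let mKs rho theta : 0 < rho ->
  measurable_fun setT (fun phi => log_kernel rho theta phi * sin phi).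
Proof.
move=> r0; apply: measurable_funM; first exact: measurable_log_kernel2.
by apply: continuous_measurable_fun; exact: continuous_sin.
Qed.

Let mKs2 rho theta : 0 < rho ->
  measurable_fun setT (fun phi => log_kernel rho theta phi * (2 * sin phi * cos phi)).
Proof.
move=> r0; apply: measurable_funM; first exact: measurable_log_kernel2.
apply: measurable_funM; last by apply: continuous_measurable_fun; exact: continuous_cos.
apply: measurable_funM; first exact: measurable_cst.
by apply: continuous_measurable_fun; exact: continuous_sin.
Qed.

Let integral_log_kernel_sin1 theta : D theta ->
  (\int[mu]_(phi in D) (log_kernel 1 theta phi * sin phi)%:E =
   (2 * pi * sin theta)%:E)%E.
Proof.
move=> Dth; rewrite -(integral_Dt theta); last exact: mKs.
pose g n phi := (log_kernel (r_ n) theta phi * sin phi)%:E.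
have r0 n : 0 < r_ n by case/andP: (r_itv n).
have mg n : measurable_fun (Dt theta) (g n).
  by apply: measurable_funTS; apply/measurable_EFinP; exact: mKs.
have g0 n x : Dt theta x -> (0 <= g n x)%E.
  by move=> [Dx _]; rewrite lee_fin mulr_ge0 ?log_kernel_ge0// ltW// sin_gt0.
have ndg x : Dt theta x -> nondecreasing_seq (g^~ x).
  move=> [Dx /= xt] m n mn; rewrite lee_fin; apply: ler_wpM2r; first by rewrite ltW// sin_gt0.
  apply: log_kernel_le => //; first exact: r_nd.
    by case/andP: (r_itv n) => _ /ltW.
  by apply/eqP => e; apply: xt.
have := @cvg_monotone_convergence _ _ R mu (Dt theta) (mDt theta) g mg g0 ndg.
have -> : (fun n => \int[mu]_(x in Dt theta) g n x)%E = (fun n => (2 * pi * r_ n * sin theta)%:E).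
  apply/funext => n; rewrite integral_Dt; last exact: mKs.
  by rewrite integral_log_kernel_sin_lt1.
rewrite (_ : (\int[mu]_(x in Dt theta) limn (g^~ x))%E =
   (\int[mu]_(x in Dt theta) (log_kernel 1 theta x * sin x)%:E)%E); last first.
  apply: eq_integral => x /set_mem Dx; apply/cvg_lim => //.
  apply: cvg_EFin; first exact: nearW.
  by apply: cvgM; [exact: cvg_log_kernel|exact: cvg_cst].
move=> c1.
suff c2 : (2 * pi * r_ n * sin theta)%:E @[n --> \oo] --> (2 * pi * sin theta)%:E.
  by apply: (cvg_unique _ c1 c2).
apply: cvg_EFin; first exact: nearW.
suff : 2 * pi * r_ n * sin theta @[n --> \oo] --> 2 * pi * 1 * sin theta by rewrite mulr1.
apply: cvgM; last exact: cvg_cst.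
by apply: cvgM; [exact: cvg_cst|exact: r_cvg].
Qed.

Lemma integral_log_kernel_sin rho theta : 0 < rho <= 1 -> D theta ->
  (\int[mu]_(phi in D) (log_kernel rho theta phi * sin phi)%:E =
   (2 * pi * rho * sin theta)%:E)%E.
Proof.
move=> /andP[r0]; rewrite le_eqVlt => /orP[/eqP -> Dth|r1 _].
  by rewrite mulr1 integral_log_kernel_sin1.
by apply: integral_log_kernel_sin_lt1; rewrite r0.
Qed.

Lemma integrable_log_kernel rho theta : 0 < rho <= 1 -> D theta ->
  mu.-integrable D (EFin \o (fun phi => log_kernel rho theta phi * sin phi)).
Proof.
move=> r Dth; have r0 : 0 < rho by case/andP: r.
apply/integrableP; split.
  by apply: measurable_funTS; apply/measurable_EFinP; exact: mKs.
rewrite (_ : (\int[mu]_(x in D) _)%E = (2 * pi * rho * sin theta)%:E) ?ltry//.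
rewrite -integral_log_kernel_sin//; apply: eq_integral => x /set_mem Dx.
by rewrite /= ger0_norm// mulr_ge0 ?log_kernel_ge0// ltW// sin_gt0.
Qed.

(** As sin (2 phi) changes sign on (0, pi), dominated convergence takes the place of the monotone
    one. The bound is 2 [log_kernel 1 theta phi] sin phi, integrable by the computation for the
    first mode. *)
Let integral_log_kernel_sin21 theta : D theta ->
  (\int[mu]_(phi in D) (log_kernel 1 theta phi * (2 * sin phi * cos phi))%:E =
   (pi * (2 * sin theta * cos theta))%:E)%E.
Proof.
move=> Dth; rewrite -(integral_Dt theta); last exact: mKs2.
pose g n phi := (log_kernel (r_ n) theta phi * (2 * sin phi * cos phi))%:E.
have r0 n : 0 < r_ n by case/andP: (r_itv n).
have mg n : measurable_fun (Dt theta) (g n).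
  by apply: measurable_funTS; apply/measurable_EFinP; exact: mKs2.
have int1 : mu.-integrable (Dt theta)
   (fun phi => 2%:E * (EFin \o (fun phi => log_kernel 1 theta phi * sin phi)%R) phi)%E.
  apply: integrableZl; first exact: mDt.
  have r1 : (0 : R) < 1 <= (1 : R) by rewrite ltr01 lexx.
  have i1 := integrable_log_kernel r1 Dth.
  apply: integrableS i1; [exact: measurable_D|exact: mDt|by move=> x []].
pose f phi := (log_kernel 1 theta phi * (2 * sin phi * cos phi))%:E.
have mf : measurable_fun (Dt theta) f.
  by apply: measurable_funTS; apply/measurable_EFinP; exact: mKs2.
have gf : {ae mu, forall x, Dt theta x -> g ^~ x @ \oo --> f x}.
  apply: aeW => x Dx; apply: cvg_EFin; first exact: nearW.
  by apply: cvgM; [exact: cvg_log_kernel|exact: cvg_cst].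
have gle : {ae mu, forall x n, Dt theta x -> (`|g n x| <=
    2%:E * (EFin \o (fun phi => log_kernel 1 theta phi * sin phi)%R) x)%E}.
  apply: aeW => x n [Dx /= xt]; rewrite -EFinM lee_fin.
  have s0 := sin_gt0 Dx; have K0 := log_kernel_ge0 (r0 n) Dth Dx.
  have KK : log_kernel (r_ n) theta x <= log_kernel 1 theta x.
    apply: log_kernel_le => //; last by apply/eqP => e; apply: xt.
    by case/andP: (r_itv n) => _ /ltW.
  rewrite !normrM (ger0_norm K0) (ger0_norm (ltW s0)) (ger0_norm (ler0n _ 2)).
  rewrite mulrCA mulrA [leRHS]mulrA [leRHS]mulrAC -!mulrA.
  have c1 : `|cos x| <= 1 by rewrite ler_norml cos_geN1 cos_le1.
  rewrite !ler_pM2l//; apply: le_trans KK; exact: ler_piMr.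
have [_ _ c1] := @dominated_convergence _ _ R mu (Dt theta) (mDt theta) g f _ mg mf gf int1 gle.
have c2 : (2 * (pi * r_ n ^+ 2 * (sin theta * cos theta)))%:E @[n --> \oo] -->
    (pi * (2 * sin theta * cos theta))%:E.
  apply: cvg_EFin; first exact: nearW.
  suff : 2 * (pi * (r_ n * r_ n) * (sin theta * cos theta)) @[n --> \oo] -->
      2 * (pi * (1 * 1) * (sin theta * cos theta)).
    by rewrite !mulr1 (mulrCA 2 pi) !mulrA.
  apply: cvgM; first exact: cvg_cst.
  apply: cvgM; last exact: cvg_cst.
  apply: cvgM; first exact: cvg_cst.
  by apply: cvgM; exact: r_cvg.
apply: (cvg_unique _ c1); first exact: ereal_hausdorff.
rewrite (_ : [sequence _]_n = (fun n => (2 * (pi * r_ n ^+ 2 * (sin theta * cos theta)))%:E))//.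
apply/funext => n /=; rewrite integral_Dt; last exact: mKs2.
by rewrite integral_log_kernel_sin2_lt1//; congr EFin; ring.
Qed.

Lemma integral_log_kernel_sin2 rho theta : 0 < rho <= 1 -> D theta ->
  (\int[mu]_(phi in D) (log_kernel rho theta phi * (2 * sin phi * cos phi))%:E =
   (pi * rho ^+ 2 * (2 * sin theta * cos theta))%:E)%E.
Proof.
move=> /andP[r0]; rewrite le_eqVlt => /orP[/eqP -> Dth|r1 _].
  by rewrite expr1n mulr1 integral_log_kernel_sin21.
by apply: integral_log_kernel_sin2_lt1; rewrite r0.
Qed.

End log_kernel_integrals.

(** * Integrability of the inner and outer integrals *)

Section bounded_continuous.
Context {R : realType}.
Local Notation mu := (@lebesgue_measure R).
Local Notation D := (`]0, pi[%classic : set R).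

Lemma continuous_D_bounded (g : R -> R) : continuous g ->
  exists2 M, 0 <= M & forall x, D x -> `|g x| <= M.
Proof.
move=> cg; have [|x _ xM] := @EVT_max R (fun x => `|g x|) 0 pi (pi_ge0 R).
  by apply: continuous_subspaceT => x; apply: cvg_norm; exact: cg.
exists `|g x|; first exact: normr_ge0.
move=> y; rewrite /= in_itv/= => /andP[y0 ypi]; apply: xM.
by rewrite in_itv/= !ltW.
Qed.

Lemma integrable_continuous_D (g : R -> R) : continuous g ->
  mu.-integrable D (EFin \o g).
Proof.
move=> cg; have i : mu.-integrable `[0, pi] (EFin \o g).
  apply: continuous_compact_integrable; first exact: segment_compact.
  exact: continuous_subspaceT.
apply: integrableS i; [exact: measurable_itv|exact: measurable_itv|].
by move=> x; rewrite /= !in_itv/= => /andP[/ltW -> /ltW ->].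
Qed.

Lemma integrableM_continuous_D (g f : R -> R) : continuous g ->
  mu.-integrable D (EFin \o f) -> mu.-integrable D (EFin \o (fun x => g x * f x)).
Proof.
move=> cg fi; have [M M0 hM] := continuous_D_bounded cg.
have mf : measurable_fun D f by apply/measurable_EFinP; exact: measurable_int fi.
have i : mu.-integrable D (fun x => M%:E * (EFin \o f) x)%E.
  by apply: integrableZl => //; exact: measurable_itv.
apply: le_integrable i.
- exact: measurable_itv.
- apply/measurable_EFinP/measurable_funM => //.
  by apply: measurable_funTS; exact: continuous_measurable_fun.
- move=> x Dx; rewrite /= lee_fin !normrM (ger0_norm M0).
  by apply: ler_wpM2r => //; exact: hM.
Qed.

End bounded_continuous.

Section double_integral.
Context {R : realType}.
Local Notation mu := (@lebesgue_measure R).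
Local Notation D := (`]0, pi[%classic : set R).
Variables (rho : R) (g : R -> R).
Hypotheses (rho01 : 0 < rho <= 1) (cg : continuous g).

Let K theta phi : R := log_kernel rho theta phi * sin phi.
Let H theta : R := \int[mu]_(phi in D) (g phi * K theta phi).

Lemma integrable_inner theta : D theta ->
  mu.-integrable D (EFin \o (fun phi => g phi * K theta phi)).
Proof. by move=> Dt; apply: integrableM_continuous_D => //; exact: integrable_log_kernel. Qed.

(** By Fubini: with |g| <= M and a nonnegative kernel, the inner integral of absolute values is at
    most M 2 pi rho sin theta <= 2 pi M, so the first-mode computation also supplies the bound.
    Integrability lets the outer integral be split into a sum. *)
Lemma integrable_H : mu.-integrable D (EFin \o H).
Proof.
have r0 : 0 < rho by case/andP: rho01.
have [M M0 hM] := continuous_D_bounded cg.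
(* Indicators restrict to the square, so that Fubini can be applied on the whole plane. *)
pose F (z : R * R) : \bar R := ((\1_D z.1 * \1_D z.2) * (g z.2 * K z.1 z.2))%:E.
have mD : measurable_fun [set: R] (\1_D : R -> R) by exact: measurable_indic.
have mF : measurable_fun setT F.
  apply/measurable_EFinP; apply: measurable_funM.
    by apply: measurable_funM; apply: measurableT_comp.
  apply: measurable_funM.
    by apply: measurableT_comp => //; exact: continuous_measurable_fun.
  apply: measurable_funM; first exact: measurable_log_kernel.
  by apply: measurableT_comp => //; apply: continuous_measurable_fun; exact: continuous_sin.
have iF : (mu \x mu)%E.-integrable setT F.
  apply: (iffRL (@integrable12ltyP _ _ (measurableTypeR R) (measurableTypeR R) R mu mu F mF)).
  apply: (@le_lt_trans _ _ (\int[mu]_x (\1_D x * (M * (2 * pi)))%:E)%E).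
    apply: ge0_le_integral => //.
    - by move=> x _; apply: integral_ge0 => y _; exact: abse_ge0.
    - apply: (@measurable_fun_fubini_tonelli_F _ _ (measurableTypeR R) (measurableTypeR R) R mu
        (abse \o F)).
        exact: measurableT_comp.
      by move=> z; exact: abse_ge0.
    - by apply/measurable_EFinP; apply: measurable_funM.
    - move=> x _; rewrite indicE; case: (boolP (x \in D)) => [/set_mem Dx|nDx]; last first.
        rewrite mul0r integral0_eq// => y _.
        by rewrite /F/= indicE (negbTE nDx) !mul0r normr0.
      rewrite mul1r.
      apply: (@le_trans _ _ (\int[mu]_(y in D) (M * K x y)%:E)%E).
        rewrite [leRHS]integral_mkcond; apply: ge0_le_integral => //.
        - apply: measurableT_comp => //.
          exact: (measurableT_comp mF (pair1_measurable x)).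
        - have mMK : measurable_fun setT (fun y : R => (M * K x y)%:E).
            apply/measurable_EFinP.
            apply: measurable_funM => //; apply: measurable_funM.
              exact: measurable_log_kernel2.
            by apply: continuous_measurable_fun; exact: continuous_sin.
          exact: ((measurable_restrictT _ measurable_D).1 (measurable_funTS mMK)).
        - move=> y _; rewrite /F/= patchE indicE mem_set// mul1r indicE.
          case: (boolP (y \in D)) => [/set_mem Dy|_]; last by rewrite mul0r normr0.
          have K0 : 0 <= K x y.
            by rewrite mulr_ge0 ?log_kernel_ge0// ltW// sin_gt0.
          by rewrite mul1r lee_fin normrM (ger0_norm K0); apply: ler_wpM2r => //; exact: hM.
      under eq_integral do rewrite EFinM.
      have i := integrable_log_kernel rho01 Dx.
      rewrite integralZl; [|exact: measurable_D|exact: i].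
      rewrite integral_log_kernel_sin// -EFinM lee_fin.
      apply: ler_wpM2l => //.
      have /andP[_ r1] := rho01; have s0 := sin_gt0 Dx; have s1 := sin_le1 x.
      have rs : rho * sin x <= 1 by nra.
      have p0 := pi_gt0 R; nra.
  under eq_integral do rewrite mulrC EFinM.
  rewrite ge0_integralZl//; last 2 first.
  - exact/measurable_EFinP.
  - by rewrite lee_fin !mulr_ge0// pi_ge0.
  rewrite integral_indic//= setIT lebesgue_measure_itv/= lte_fin pi_gt0.
  by rewrite -EFinB -EFinM ltry.
have i0 := integrable_fubini_F iF.
have i1 : mu.-integrable D (fubini_F mu F).
  by apply: integrableS i0; [exact: measurableT|exact: measurable_D|exact: subsetT].
move: i1; apply: eq_integrable; first exact: measurable_D.
move=> x /set_mem Dx; rewrite /fubini_F /H /Rintegral/= fineK; last first.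
  by apply: integrable_fin_num; [exact: measurable_D|exact: integrable_inner].
rewrite [RHS]integral_mkcond; apply: eq_integral => y _.
rewrite /F/= patchE indicE mem_set// mul1r indicE.
by case: (boolP (y \in D)) => _; rewrite ?mul1r ?mul0r.
Qed.

End double_integral.

(** * The free field kernel in polar coordinates *)

Section kernels.
Context {R : realType}.
Local Notation mu := (@lebesgue_measure R).
Local Notation D := (`]0, pi[%classic : set R).
Implicit Types (f g : {poly R}) (t theta phi : R).

Lemma ln_sqrt (x : R) : 0 <= x -> ln (Num.sqrt x) = ln x / 2.
Proof.
rewrite le_eqVlt => /orP[/eqP <-|x0]; first by rewrite sqrtr0 ln0// mul0r.
have s0 : 0 < Num.sqrt x by rewrite sqrtr_gt0.
have {2}-> : x = Num.sqrt x * Num.sqrt x by rewrite -expr2 sqr_sqrtr// ltW.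
by rewrite lnM ?posrE//; field.
Qed.

Definition rratio t t' : R := Num.sqrt (Num.min t t') / Num.sqrt (Num.max t t').

Lemma rratio01 t t' : 0 < t -> 0 < t' -> 0 < rratio t t' <= 1.
Proof.
move=> t0 t'0; rewrite /rratio.
have m0 : 0 < Num.min t t' by rewrite lt_min t0.
have M0 : 0 < Num.max t t' by rewrite lt_max t0.
rewrite divr_gt0 ?sqrtr_gt0//= ler_pdivrMr ?sqrtr_gt0// mul1r ler_wsqrtr//.
by rewrite ge_min le_max lexx.
Qed.

(** Inverting rho multiplies both squared distances by rho^-2. The ratio of radii may thus be taken
    at most 1, whichever point is farther from the origin. *)
Lemma log_kernelV rho theta phi : 0 < rho -> log_kernel rho^-1 theta phi = log_kernel rho theta phi.
Proof.
move=> r0; have n0 := lt0r_neq0 r0.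
have h psi : dist2 rho^-1 psi = rho ^- 2 * dist2 rho psi by rewrite /dist2; field.
rewrite /log_kernel !h; congr ln.
by rewrite -mulf_div divff ?mul1r// invr_neq0// expf_neq0.
Qed.

Lemma log_kernel_rratio t t' theta phi : 0 < t -> 0 < t' ->
  log_kernel (Num.sqrt t' / Num.sqrt t) theta phi = log_kernel (rratio t t') theta phi.
Proof.
move=> t0 t'0; rewrite /rratio; have [tt|tt] := leP t t'.
  by rewrite -log_kernelV ?invf_div// divr_gt0 ?sqrtr_gt0.
by [].
Qed.

Lemma gff_kernel_polar t t' theta phi : 0 < t -> 0 < t' ->
  gff_kernel (polar t theta) (polar t' phi) =
  (4 * pi)^-1 * log_kernel (rratio t t') theta phi.
Proof.
move=> t0 t'0; rewrite -log_kernel_rratio//.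
rewrite /gff_kernel /polar.
set r := Num.sqrt t; set r' := Num.sqrt t'.
have r0 : 0 < r by rewrite sqrtr_gt0.
have r'0 : 0 < r' by rewrite sqrtr_gt0.
have nr := lt0r_neq0 r0.
rewrite Normc.normcM Normc.normcV/=.
have e1 : (r * cos theta - r' * cos phi) ^+ 2 + (r * sin theta - r' * sin phi) ^+ 2 =
   r ^+ 2 * dist2 (r' / r) (theta - phi).
  rewrite /dist2 cosB.
  transitivity (r ^+ 2 * (cos theta ^+ 2 + sin theta ^+ 2) + r' ^+ 2 * (cos phi ^+ 2 + sin phi ^+ 2)
     - 2 * r * r' * (cos theta * cos phi + sin theta * sin phi)); first by ring.
  by rewrite !cos2Dsin2; field.
have e2 : (r * cos theta - r' * cos phi) ^+ 2 + (r * sin theta - - (r' * sin phi)) ^+ 2 =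
   r ^+ 2 * dist2 (r' / r) (theta + phi).
  rewrite /dist2 cosD.
  transitivity (r ^+ 2 * (cos theta ^+ 2 + sin theta ^+ 2) + r' ^+ 2 * (cos phi ^+ 2 + sin phi ^+ 2)
     - 2 * r * r' * (cos theta * cos phi - sin theta * sin phi)); first by ring.
  by rewrite !cos2Dsin2; field.
rewrite e1 e2.
have q0 : 0 <= r' / r by rewrite divr_ge0// ltW.
have d1 := dist2_ge0 (theta - phi) q0; have d2 := dist2_ge0 (theta + phi) q0.
set a := dist2 _ (theta - phi) in d1 *; set b := dist2 _ (theta + phi) in d2 *.
have -> : Num.sqrt (r ^+ 2 * a) / Num.sqrt (r ^+ 2 * b) = Num.sqrt (a / b).
  rewrite !(sqrtrM _ (sqr_ge0 r)) -mulf_div divff ?mul1r.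
    by rewrite sqrtrM// sqrtrV.
  by rewrite sqrtr_sqr normr_eq0.
rewrite ln_sqrt ?divr_ge0//.
(* The identity survives a vanishing distance: both quotients are then 0 and both logarithms take
   the default value 0. *)
have -> : ln (a / b) = - log_kernel (r' / r) theta phi.
  rewrite /log_kernel -/a -/b.
  move: d1; rewrite le_eqVlt => /orP[/eqP <-|a0].
    by rewrite mul0r invr0 mulr0 ln0// oppr0.
  move: d2; rewrite le_eqVlt => /orP[/eqP <-|b0].
    by rewrite mul0r invr0 mulr0 ln0// oppr0.
  by rewrite -lnV ?invf_div// posrE divr_gt0.
have p0 : (pi : R) != 0 by rewrite gt_eqF ?pi_gt0.
by move: p0; move: (@pi R) => p p0; field.
Qed.

End kernels.

(** * Covariances with the modes *)

Section kernel_covariance.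
Context {R : realType}.
Local Notation mu := (@lebesgue_measure R).
Local Notation D := (`]0, pi[%classic : set R).
Implicit Types (f g : {poly R}) (t theta phi : R).

Definition on_arc f t theta : R := f.[2 * Num.sqrt t * cos theta].

Lemma continuous_on_arc f t : continuous (on_arc f t).
Proof.
move=> x; apply: (continuous_comp (f := fun x => 2 * Num.sqrt t * cos x) (g := horner f)).
  by apply: cvgM; [exact: cvg_cst|exact: continuous_cos].
exact: continuous_horner.
Qed.

(** One factor sin theta is the angular profile of the first mode, the other comes from dx; in
    [mode_int2] the profile is sin (2 theta), written as 2 sin cos. *)
Definition mode_int1 f t : R := \int[mu]_(theta in D) (on_arc f t theta * sin theta ^+ 2).
Definition mode_int2 f t : R :=
  \int[mu]_(theta in D) (on_arc f t theta * (2 * sin theta * cos theta) * sin theta).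

Lemma continuous_mode_int1 f t : continuous (fun theta => on_arc f t theta * sin theta ^+ 2).
Proof.
move=> x; apply: cvgM; first exact: continuous_on_arc.
by under eq_fun do rewrite expr2; rewrite expr2; apply: cvgM; exact: continuous_sin.
Qed.

Lemma continuous_sin2 : continuous (fun theta : R => 2 * sin theta * cos theta).
Proof.
move=> x; apply: cvgM; last exact: continuous_cos.
by apply: cvgM; [exact: cvg_cst|exact: continuous_sin].
Qed.

Lemma continuous_mode_int2 f t :
  continuous (fun theta => on_arc f t theta * (2 * sin theta * cos theta) * sin theta).
Proof.
move=> x; apply: cvgM; last exact: continuous_sin.
by apply: cvgM; [exact: continuous_on_arc|exact: continuous_sin2].
Qed.

Lemma polar_normc t theta : 0 < t -> Normc.normc (polar t theta) = Num.sqrt t.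
Proof.
move=> t0; rewrite /polar /= !exprMn -mulrDr cos2Dsin2 mulr1 sqrtr_sqr ger0_norm//.
Qed.

Lemma Im_inv_polar t theta : 0 < t ->
  complex.Im (1 / polar t theta) = - (sin theta / Num.sqrt t).
Proof.
move=> t0; have s0 : Num.sqrt t != 0 by rewrite gt_eqF ?sqrtr_gt0.
rewrite /polar mul1r /= !exprMn -mulrDr cos2Dsin2 mulr1; field; exact: s0.
Qed.

Lemma Im_inv_polar2 t theta : 0 < t ->
  complex.Im (1 / polar t theta ^+ 2) = - (2 * sin theta * cos theta / t).
Proof.
move=> t0; have n0 := lt0r_neq0 t0.
have s0 : Num.sqrt t != 0 by rewrite gt_eqF ?sqrtr_gt0.
have ss : Num.sqrt t ^+ 2 = t by rewrite sqr_sqrtr// ltW.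
rewrite expr2 /polar mul1r /=.
set c := cos theta; set s := sin theta; set r := Num.sqrt t.
have e : (r * c * (r * c) - r * s * (r * s)) ^+ 2 + (r * c * (r * s) + r * s * (r * c)) ^+ 2 =
    t ^+ 2.
  transitivity ((r ^+ 2 * (c ^+ 2 + s ^+ 2)) ^+ 2); first by ring.
  by rewrite ss cos2Dsin2 mulr1.
rewrite e; transitivity (- (r ^+ 2 * (2 * s * c)) / t ^+ 2); first by field.
by rewrite ss; field.
Qed.

Section fixed.
Variables (f g : {poly R}) (t t' : R).
Hypotheses (t0 : 0 < t) (t'0 : 0 < t').
Let rho := rratio t t'.
Let rho01 : 0 < rho <= 1. Proof. exact: rratio01. Qed.
Let K theta phi : R := log_kernel rho theta phi * sin phi.
Let H theta : R := \int[mu]_(phi in D) (on_arc g t' phi * K theta phi).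
(** The constant is 4 sqrt (t t'), from the two arc elements, times the 1 / (4 pi) of the kernel. *)
Let c theta : R := Num.sqrt (t * t') / pi * (on_arc f t theta * sin theta).

Let cc : continuous c.
Proof.
move=> x; apply: cvgM; first exact: cvg_cst.
by apply: cvgM; [exact: continuous_on_arc|exact: continuous_sin].
Qed.

Let pi0 : (pi : R) != 0. Proof. by rewrite gt_eqF ?pi_gt0. Qed.

Let icH : mu.-integrable D (EFin \o (fun theta => c theta * H theta)).
Proof.
apply: integrableM_continuous_D; first exact: cc.
by apply: integrable_H => //; exact: continuous_on_arc.
Qed.

Let inner theta : D theta ->
  mu.-integrable D (EFin \o (fun phi => on_arc g t' phi * K theta phi)).
Proof. by move=> Dt; apply: integrable_inner => //; exact: continuous_on_arc. Qed.

Lemma gff_covarianceE :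
  kernel_covariance gff_kernel f t g t' = \int[mu]_(theta in D) (c theta * H theta).
Proof.
apply: eq_Rintegral => theta /set_mem Dt.
rewrite -RintegralZl//; last exact: inner.
apply: eq_Rintegral => phi /set_mem Dp.
rewrite gff_kernel_polar// -/rho /c /K /on_arc; move: pi0; move: (@pi R) => p p0; by field.
Qed.

Let tt : Num.sqrt (t * t') = Num.sqrt t * Num.sqrt t'.
Proof. by rewrite sqrtrM// ltW. Qed.

Variables (a b : R).

(** The product Im(1/z) Im(1/w) contributes 1 / sqrt (t t'), which the arc elements cancel. In [A2],
    Im(1/z^2) Im(1/w^2) contributes 1 / (t t'), of which 1 / sqrt (t t') remains. *)
Let A1 := 4 / pi * (1 - a) * Num.min t t'.
Let A2 := 2 / pi * (2 - b) * Num.min (t ^+ 2) (t' ^+ 2) / Num.sqrt (t * t').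

Lemma Cab_covarianceE :
  kernel_covariance (Cab_kernel a b) f t g t' =
  kernel_covariance gff_kernel f t g t' - A1 * (mode_int1 f t * mode_int1 g t')
    - A2 * (mode_int2 f t * mode_int2 g t').
Proof.
have mD : measurable D by exact: measurable_itv.
pose f1 (h : {poly R}) s x := on_arc h s x * sin x ^+ 2.
pose f2 (h : {poly R}) s x := on_arc h s x * (2 * sin x * cos x) * sin x.
have i1 h s : mu.-integrable D (EFin \o f1 h s).
  by apply: integrable_continuous_D; exact: continuous_mode_int1.
have i2 h s : mu.-integrable D (EFin \o f2 h s).
  by apply: integrable_continuous_D; exact: continuous_mode_int2.
have iZ k (u : R -> R) : mu.-integrable D (EFin \o u) ->
    mu.-integrable D (EFin \o (fun x => k * u x)).
  move=> iu.
  have : mu.-integrable D (fun x => k%:E * (EFin \o u) x)%E by exact: integrableZl.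
  by apply: eq_integrable => // x _ /=; rewrite EFinM.
have iB (u v : R -> R) : mu.-integrable D (EFin \o u) -> mu.-integrable D (EFin \o v) ->
    mu.-integrable D (EFin \o (fun x => u x - v x)).
  move=> iu iv.
  have : mu.-integrable D ((EFin \o u) \- (EFin \o v))%E by exact: integrableB.
  by apply: eq_integrable => // x _ /=; rewrite EFinB.
rewrite gff_covarianceE.
transitivity (\int[mu]_(theta in D) (c theta * H theta
   - (A1 * mode_int1 g t') * f1 f t theta - (A2 * mode_int2 g t') * f2 f t theta)).
  apply: eq_Rintegral => theta /set_mem Dt.
  transitivity (\int[mu]_(phi in D) (c theta * (on_arc g t' phi * K theta phi)
     - (A1 * f1 f t theta) * f1 g t' phi - (A2 * f2 f t theta) * f2 g t' phi)).
    apply: eq_Rintegral => phi /set_mem Dp.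
    rewrite /Cab_kernel gff_kernel_polar// !polar_normc//.
    rewrite !Im_inv_polar// !Im_inv_polar2//.
    have n4 (s : R) : 0 < s -> Num.sqrt s ^+ 4 = s ^+ 2.
      by move=> s0; rewrite (_ : 4 = 2 * 2)%N// exprM sqr_sqrtr// ltW.
    rewrite !n4// !sqr_sqrtr ?(ltW t0) ?(ltW t'0)//.
    rewrite -/rho /c /K /f1 /f2 /on_arc /A1 /A2.
    have ht : t = Num.sqrt t ^+ 2 by rewrite sqr_sqrtr// ltW.
    have ht' : t' = Num.sqrt t' ^+ 2 by rewrite sqr_sqrtr// ltW.
    have st : Num.sqrt t != 0 by rewrite gt_eqF ?sqrtr_gt0.
    have st' : Num.sqrt t' != 0 by rewrite gt_eqF ?sqrtr_gt0.
    have e1 : 2 * sin theta * cos theta / t = 2 * sin theta * cos theta / Num.sqrt t ^+ 2 by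
        rewrite -ht.
    have e2 : 2 * sin phi * cos phi / t' = 2 * sin phi * cos phi / Num.sqrt t' ^+ 2 by rewrite -ht'.
    rewrite tt e1 e2; set m1 := Num.min _ _; set m2 := Num.min _ _.
    set ff := f.[_]; set gg := g.[_]; set kk := log_kernel _ _ _.
    move: st st'.
    set r := Num.sqrt t; set r' := Num.sqrt t' => nr nr'.
    by move: pi0; move: (@pi R) => p p0; field; rewrite p0 nr nr'.
  (* Splitting the integrals requires each term to be integrable: the logarithmic one by the Fubini
     argument, the others by continuity. *)
  have j1 := inner Dt.
  rewrite RintegralB//; last 2 first.
  - by apply: iB; apply: iZ; [exact: j1|exact: i1].
  - by apply: iZ; exact: i2.
  rewrite RintegralB//; last 2 first.
  - by apply: iZ.
  - by apply: iZ; exact: i1.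
  rewrite !RintegralZl//.
  by rewrite -/(mode_int1 g t') -/(mode_int2 g t') -/(H theta); ring.
rewrite RintegralB//; last 2 first.
- by apply: iB => //; apply: iZ; exact: i1.
- by apply: iZ; exact: i2.
rewrite RintegralB//; last first.
- by apply: iZ; exact: i1.
rewrite !RintegralZl//.
by rewrite -/(mode_int1 f t) -/(mode_int2 f t); ring.
Qed.

End fixed.

(** Turns the factor rho returned by the first-mode integral, and rho^2 for the second, into the
    minima that are Brownian covariances. *)
Lemma sqrt_rratio t t' : 0 < t -> 0 < t' ->
  Num.sqrt (t * t') * rratio t t' = Num.min t t'.
Proof.
move=> t0 t'0; rewrite /rratio.
have -> : t * t' = Num.min t t' * Num.max t t'.
  by have [_|_] := leP t t'; rewrite // mulrC.
have m0 : 0 < Num.min t t' by rewrite lt_min t0.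
have M0 : 0 < Num.max t t' by rewrite lt_max t0.
rewrite sqrtrM ?(ltW m0)// mulrACA mulrA mulfK ?gt_eqF ?sqrtr_gt0//.
by rewrite -expr2 sqr_sqrtr// ltW.
Qed.

Lemma gff_covariance1 f t t' : 0 < t -> 0 < t' ->
  kernel_covariance gff_kernel f t 1 t' = 2 * Num.min t t' * mode_int1 f t.
Proof.
move=> t0 t'0; rewrite gff_covarianceE//.
have p0 : (pi : R) != 0 by rewrite gt_eqF ?pi_gt0.
rewrite /mode_int1 -RintegralZl; last 2 first.
- exact: measurable_itv.
- by apply: integrable_continuous_D; exact: continuous_mode_int1.
apply: eq_Rintegral => theta /set_mem Dt.
rewrite (_ : \int[mu]_(phi in D) _ = 2 * pi * rratio t t' * sin theta); last first.
  rewrite /Rintegral -[RHS]/(fine (2 * pi * rratio t t' * sin theta)%:E).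
  rewrite -(integral_log_kernel_sin (rratio01 t0 t'0) Dt); congr fine.
  by apply: eq_integral => phi _; rewrite /on_arc hornerC mul1r.
by rewrite -sqrt_rratio//; move: p0; move: (@pi R) => p p0; field.
Qed.

Lemma gff_covarianceX f t t' : 0 < t -> 0 < t' ->
  kernel_covariance gff_kernel f t 'X t' =
  Num.min (t ^+ 2) (t' ^+ 2) / Num.sqrt t * mode_int2 f t.
Proof.
move=> t0 t'0; rewrite gff_covarianceE//.
have p0 : (pi : R) != 0 by rewrite gt_eqF ?pi_gt0.
rewrite /mode_int2 -RintegralZl; last 2 first.
- exact: measurable_itv.
- by apply: integrable_continuous_D; exact: continuous_mode_int2.
apply: eq_Rintegral => theta /set_mem Dt.
rewrite (_ : \int[mu]_(phi in D) _ = Num.sqrt t' * (pi * rratio t t' ^+ 2 * (2 * sin theta *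
    cos theta))); last first.
  have i2 := integrable_log_kernel (rratio01 t0 t'0) Dt.
  have i3 := integrableM_continuous_D (@continuous_on_arc 'X t') i2.
  have E := integral_log_kernel_sin2 (rratio01 t0 t'0) Dt.
  have s0 : Num.sqrt t' != 0 by rewrite gt_eqF ?sqrtr_gt0.
  transitivity (\int[mu]_(phi in D) (Num.sqrt t' * (log_kernel (rratio t t') theta phi * (2 *
      sin phi * cos phi)))).
    by apply: eq_Rintegral => phi _; rewrite /on_arc hornerX; ring.
  rewrite RintegralZl; last 2 first.
  - exact: measurable_itv.
  (* On the arc x is 2 sqrt t' cos phi, so the integrand with sin (2 phi) is, up to 1 / sqrt t', the
     one already known to be integrable. *)
  - have : mu.-integrable D (fun x => ((Num.sqrt t')^-1)%:E *
        (EFin \o (fun phi => on_arc 'X t' phi * (log_kernel (rratio t t') theta phi * sin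
            phi))%R) x)%E.
      by apply: integrableZl => //; exact: measurable_itv.
    apply: eq_integrable; first exact: measurable_itv.
    by move=> phi _ /=; rewrite -EFinM /on_arc hornerX; congr EFin; field.
  by rewrite /Rintegral E.
have -> : Num.min (t ^+ 2) (t' ^+ 2) = Num.min t t' ^+ 2.
  have [tt|tt] := leP t t'.
    by rewrite min_l// ler_pXn2r ?nnegrE ?(ltW t0) ?(ltW t'0).
  by rewrite min_r// ler_pXn2r ?nnegrE ?(ltW t0) ?(ltW t'0) ?(ltW tt).
rewrite -sqrt_rratio//.
have st : Num.sqrt t != 0 by rewrite gt_eqF ?sqrtr_gt0.
by rewrite sqrtrM ?(ltW t0)//; move: p0; move: (@pi R) => p p0; field; rewrite p0 st.
Qed.

Lemma Rintegral_D_is_derive (u F : R -> R) : (forall x : R, is_derive x (1 : R) F (u x)) ->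
  continuous u -> \int[mu]_(x in D) u x = F pi - F 0.
Proof.
move=> dF cu; rewrite /Rintegral -(integral_itv_bndoo true false); last first.
  by apply: measurable_funTS; apply/measurable_EFinP; exact: continuous_measurable_fun.
by rewrite (integral_itv_is_derive (pi_gt0 R) dF cu).
Qed.

Lemma mode_int1_1 t : mode_int1 1 t = pi / 2.
Proof.
have d (x : R) : is_derive x (1 : R) (fun x => (x - sin x * cos x) / 2)
    (on_arc 1 t x * sin x ^+ 2).
  apply: is_derive_eq; rewrite /GRing.scale/= /on_arc hornerC.
  have := cos2Dsin2 x; lra.
have := Rintegral_D_is_derive d (@continuous_mode_int1 1 t); rewrite -/(mode_int1 1 t) => ->.
by rewrite sinpi sin0; ring.
Qed.

(** Together with [mode_int1_X], this is the orthogonality of sin and sin (2 theta) on (0, pi), the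
    reason why the two modes are uncorrelated. *)
Lemma mode_int2_1 t : mode_int2 1 t = 0.
Proof.
have d (x : R) : is_derive x (1 : R) (fun x => 2 / 3 * (sin x * sin x * sin x))
    (on_arc 1 t x * (2 * sin x * cos x) * sin x).
  by apply: is_derive_eq; rewrite /GRing.scale/= /on_arc hornerC; field.
have := Rintegral_D_is_derive d (@continuous_mode_int2 1 t); rewrite -/(mode_int2 1 t) => ->.
by rewrite sinpi sin0; ring.
Qed.

Lemma mode_int1_X t : mode_int1 'X t = 0.
Proof.
have d (x : R) : is_derive x (1 : R)
    (fun x => 2 * Num.sqrt t / 3 * (sin x * sin x * sin x)) (on_arc 'X t x * sin x ^+ 2).
  by apply: is_derive_eq; rewrite /GRing.scale/= /on_arc hornerX; field.
have := Rintegral_D_is_derive d (@continuous_mode_int1 'X t); rewrite -/(mode_int1 'X t) => ->.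
by rewrite sinpi sin0; ring.
Qed.

Lemma mode_int2_X t : mode_int2 'X t = Num.sqrt t * (pi / 2).
Proof.
have d (x : R) : is_derive x (1 : R)
    (* The product sin cos (cos^2 - sin^2) is sin (4 x) / 4, so this is the usual primitive of sin^2
       (2 x), times sqrt t. *)
    (fun x => Num.sqrt t * ((x - sin x * cos x * (cos x * cos x - sin x * sin x)) / 2))
    (on_arc 'X t x * (2 * sin x * cos x) * sin x).
  apply: is_derive_eq; rewrite /GRing.scale/= /on_arc hornerX; set r := Num.sqrt t.
  apply/eqP; rewrite -subr_eq0; apply/eqP.
  transitivity (r / 2 * (1 - (cos x ^+ 2 + sin x ^+ 2) ^+ 2)); first by field.
  by rewrite cos2Dsin2 expr1n subrr mulr0.
have := Rintegral_D_is_derive d (@continuous_mode_int2 'X t); rewrite -/(mode_int2 'X t) => ->.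
by rewrite sinpi sin0; ring.
Qed.

End kernel_covariance.

(** * Noisy and conditioned fields *)

Section noisy_fields.
Context (R : realType) (d : measure_display) (T : measurableType d)
  (P : probability T R).
Variable G : gfield R T.
Hypothesis hG : gaussian_field_with_kernel P G gff_kernel.
Variables B1 B2 : R -> T -> R.
Hypotheses (hB1 : brownian_motion P B1) (hB2 : brownian_motion P B2)
  (hind : independent_noises P G B1 B2).
Local Notation law := (has_centered_normal_law P).
Local Notation L2 := (Lfun P 2%:E).
Implicit Types (f g : {poly R}) (t s : R).

(* noise1 and noise2 have covariances mode_cov1 and mode_cov2, which are those of
   the modes G(1, t) and G(x, t) themselves. *)
Definition mode_coef1 f t : R := mode_int1 f t / (pi / 2).
Definition mode_coef2 f t : R := mode_int2 f t / (Num.sqrt t * (pi / 2)).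
Definition mode_cov1 t t' : R := pi * Num.min t t'.
Definition mode_cov2 t t' : R := pi / 2 * Num.min (t ^+ 2) (t' ^+ 2).
Definition noise1 t w : R := Num.sqrt pi * B1 t w.
Definition noise2 t w : R := Num.sqrt (pi / 2) * B2 (t ^+ 2) w.

Let pi0 : (pi : R) != 0. Proof. by rewrite gt_eqF ?pi_gt0. Qed.

Lemma mode_coef1_1 t : mode_coef1 1 t = 1.
Proof. by rewrite /mode_coef1 mode_int1_1 divff// mulf_neq0// invr_neq0. Qed.

Lemma mode_coef1_X t : mode_coef1 'X t = 0. Proof. by rewrite /mode_coef1 mode_int1_X mul0r. Qed.

Lemma mode_coef2_1 t : mode_coef2 1 t = 0. Proof. by rewrite /mode_coef2 mode_int2_1 mul0r. Qed.

Lemma mode_coef2_X t : 0 < t -> mode_coef2 'X t = 1.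
Proof.
move=> t0; rewrite /mode_coef2 mode_int2_X divff// !mulf_neq0// ?invr_neq0//.
by rewrite gt_eqF ?sqrtr_gt0.
Qed.

Let spanG := linear_span [set G i.1 i.2 | i in [set i : {poly R} * R | 0 < i.2]].
Let spanB (B : R -> T -> R) := linear_span [set B t | t in [set t | 0 <= t]].

(** Contains all fields of the proof and their explicit projections. The three parts are kept apart
    because independence is known between them. *)
Definition gspan X := exists X0 X1 X2,
  [/\ spanG X0, spanB B1 X1, spanB B2 X2 & X = X0 \+ (X1 \+ X2)].

Lemma gspanD X Y : gspan X -> gspan Y -> gspan (X \+ Y).
Proof.
move=> [X0 [X1 [X2 [x0 x1 x2 ->]]]] [Y0 [Y1 [Y2 [y0 y1 y2 ->]]]].
exists (X0 \+ Y0), (X1 \+ Y1), (X2 \+ Y2); split; try exact: linear_spanD.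
by apply/funext => w /=; ring.
Qed.

Lemma gspanZ k X : gspan X -> gspan (fun w => k * X w).
Proof.
move=> [X0 [X1 [X2 [x0 x1 x2 ->]]]].
exists (fun w => k * X0 w), (fun w => k * X1 w), (fun w => k * X2 w).
split; try exact: linear_spanZ.
by apply/funext => w /=; ring.
Qed.

Lemma gspan_G f t : 0 < t -> gspan (G f t).
Proof.
move=> t0; exists (G f t), (cst 0), (cst 0); split; try exact: linear_span0.
  by apply: linear_span_sub; exists (f, t).
by apply/funext => w /=; rewrite !addr0.
Qed.

Lemma gspan_B1 t : 0 <= t -> gspan (B1 t).
Proof.
move=> t0; exists (cst 0), (B1 t), (cst 0); split; try exact: linear_span0.
  by apply: linear_span_sub; exists t.
by apply/funext => w /=; rewrite addr0 add0r.
Qed.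

Lemma gspan_B2 t : 0 <= t -> gspan (B2 t).
Proof.
move=> t0; exists (cst 0), (cst 0), (B2 t); split; try exact: linear_span0.
  by apply: linear_span_sub; exists t.
by apply/funext => w /=; rewrite !add0r.
Qed.

Lemma spanG_law X : spanG X -> exists s, law s X.
Proof.
move=> [n [c [Y [SY ->]]]].
have /choice[i iP] : forall k, exists i : {poly R} * R, 0 < i.2 /\ G i.1 i.2 = Y k.
  by move=> k; have [i i0 iE] := SY k; exists i.
have [gG _] := hG.
have [s hs] := gG n c (fun k => (i k).1) (fun k => (i k).2) (fun k => (iP k).1).
exists s; move: hs; congr (law s _); apply/funext => w.
by apply: eq_bigr => k _; rewrite (iP k).2.
Qed.

(** The relation between s, s1 and s2 is recorded because [rcov_law_indep] converts it into a
    vanishing covariance. *)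
Lemma spanB_law X1 X2 : spanB B1 X1 -> spanB B2 X2 ->
  exists s1 s2 s, [/\ law s1 X1, law s2 X2, law s (X1 \+ X2) & s ^+ 2 = s1 ^+ 2 + s2 ^+ 2].
Proof.
move=> x1 x2; have [s1 h1] := brownian_span_gaussian hB1 x1.
have [s2 h2] := brownian_span_gaussian hB2 x2.
have [i12 _] := hind.
have [|s ss hs] := has_centered_normal_lawD h1 h2; last by exists s1, s2, s.
move=> A A' mA mA'; apply: i12.
- exact: (linear_span_sigma (@sigma_of_sigma_algebra _ _ _ _ _ _) (@subset_refl _ _) x1).
- exact: (linear_span_sigma (@sigma_of_sigma_algebra _ _ _ _ _ _) (@subset_refl _ _) x2).
Qed.

Lemma gspan_law0 X0 X1 X2 : spanG X0 -> spanB B1 X1 -> spanB B2 X2 ->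
  exists s0 s12 s, [/\ law s0 X0, law s12 (X1 \+ X2), law s (X0 \+ (X1 \+ X2)) &
    s ^+ 2 = s0 ^+ 2 + s12 ^+ 2].
Proof.
move=> x0 x1 x2; have [s0 h0] := spanG_law x0.
have [s1 [s2 [s12 [h1 h2 h12 _]]]] := spanB_law x1 x2.
have [_ i012] := hind.
have [|s ss hs] := has_centered_normal_lawD h0 h12; last by exists s0, s12, s.
move=> A A' mA mA'; apply: i012.
  exact: (linear_span_sigma (@sigma_of_sigma_algebra _ _ _ _ _ _) (@subset_refl _ _) x0).
(* The two motions are merged into one family, so that [linear_span_sigma] applies to the
   sigma-algebra they generate jointly. *)
pose B (i : bool * R) := if i.1 then B1 i.2 else B2 i.2.
apply: (@linear_span_sigma _ _ _ _ [set i : bool * R | 0 <= i.2] B) => //.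
- apply: (smallest_sub (smallest_sigma_algebra _ _)).
  move=> C [[i t] t0 BC]; apply: sub_sigma_algebra; case: i BC t0 => BC t0; [left|right];
    by apply: sub_sigma_algebra; exists t.
- apply: linear_spanD.
    by apply: linear_spanS x1 => _ [t t0 <-]; exists (true, t).
  by apply: linear_spanS x2 => _ [t t0 <-]; exists (false, t).
Qed.

Lemma gspan_law X : gspan X -> exists s, law s X.
Proof.
move=> [X0 [X1 [X2 [x0 x1 x2 ->]]]].
by have [s0 [s12 [s [_ _ hs _]]]] := gspan_law0 x0 x1 x2; exists s.
Qed.

Lemma gspan_Lfun2 X : gspan X -> X \in L2.
Proof. by move=> /gspan_law[s]; exact: centered_normal_Lfun2. Qed.

Lemma gspan_expectation X : gspan X -> ('E_P[X] = 0)%E.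
Proof. by move=> /gspan_law[s]; exact: expectation_centered_normal. Qed.

Lemma rcov_G_B X0 X1 X2 : spanG X0 -> spanB B1 X1 -> spanB B2 X2 -> rcov P X0 (X1 \+ X2) = 0.
Proof.
move=> x0 x1 x2; have [s0 [s12 [s [h0 h12 hs ss]]]] := gspan_law0 x0 x1 x2.
exact: rcov_law_indep h0 h12 hs ss.
Qed.

Lemma rcov_G_B1 f t s : 0 < t -> 0 <= s -> rcov P (G f t) (B1 s) = 0.
Proof.
move=> t0 s0; rewrite (_ : B1 s = B1 s \+ cst 0); last by apply/funext => w /=; rewrite addr0.
apply: rcov_G_B; last exact: linear_span0.
  by apply: linear_span_sub; exists (f, t).
by apply: linear_span_sub; exists s.
Qed.

Lemma rcov_G_B2 f t s : 0 < t -> 0 <= s -> rcov P (G f t) (B2 s) = 0.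
Proof.
move=> t0 s0; rewrite (_ : B2 s = cst 0 \+ B2 s); last by apply/funext => w /=; rewrite add0r.
apply: rcov_G_B; first (by apply: linear_span_sub; exists (f, t)); first exact: linear_span0.
by apply: linear_span_sub; exists s.
Qed.

Lemma rcov_B1_B2 s t : 0 <= s -> 0 <= t -> rcov P (B1 s) (B2 t) = 0.
Proof.
move=> s0 t0; have x1 : spanB B1 (B1 s) by apply: linear_span_sub; exists s.
have x2 : spanB B2 (B2 t) by apply: linear_span_sub; exists t.
have [s1 [s2 [s' [h1 h2 h ss]]]] := spanB_law x1 x2.
exact: rcov_law_indep h1 h2 h ss.
Qed.

Lemma rcov_G f t g t' : 0 < t -> 0 < t' ->
  rcov P (G f t) (G g t') = kernel_covariance gff_kernel f t g t'.
Proof. by move=> t0 t'0; have [_ c] := hG; rewrite /rcov c. Qed.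

Lemma rcov_G1 f t t' : 0 < t -> 0 < t' -> rcov P (G f t) (G 1 t') = mode_coef1 f t * mode_cov1 t t'.
Proof.
move=> t0 t'0; rewrite rcov_G// gff_covariance1// /mode_coef1 /mode_cov1.
by move: pi0; move: (@pi R) => p p0; field.
Qed.

Lemma rcov_GX f t t' : 0 < t -> 0 < t' -> rcov P (G f t) (G 'X t') = mode_coef2 f t * mode_cov2
    t t'.
Proof.
move=> t0 t'0; rewrite rcov_G// gff_covarianceX// /mode_coef2 /mode_cov2.
have st : Num.sqrt t != 0 by rewrite gt_eqF ?sqrtr_gt0.
by move: pi0; move: (@pi R) => p p0; field; rewrite p0 st.
Qed.

(** Target of every case: it has the shape of [rcov_noisy], with a - 1 and b - 2 in place of the
    products of amplitudes. *)
Lemma Cab_covariance_u (a b : R) f t g t' : 0 < t -> 0 < t' ->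
  kernel_covariance (Cab_kernel a b) f t g t' = rcov P (G f t) (G g t')
   - (1 - a) * (mode_coef1 f t * mode_coef1 g t' * mode_cov1 t t') - (2 - b) * (mode_coef2 f t
       * mode_coef2 g t' * mode_cov2 t t').
Proof.
move=> t0 t'0; rewrite Cab_covarianceE// rcov_G// /mode_coef1 /mode_coef2 /mode_cov1 /mode_cov2
    sqrtrM ?(ltW t0)//.
have st : Num.sqrt t != 0 by rewrite gt_eqF ?sqrtr_gt0.
have st' : Num.sqrt t' != 0 by rewrite gt_eqF ?sqrtr_gt0.
set m2 := Num.min (_ ^+ 2) _.
by move: pi0; move: (@pi R) => p p0; field; rewrite p0 st st'.
Qed.

(** The minus sign of the noise cancels that of the orientation, and the Brownian factor leaves the
    angular integral. *)
Lemma eta1E f t w : 0 < t -> eta1 B1 f t w = mode_coef1 f t * noise1 t w.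
Proof.
move=> t0; rewrite /eta1 /field_of_fun.
have st : Num.sqrt t != 0 by rewrite gt_eqF ?sqrtr_gt0.
have sp : Num.sqrt (pi : R) != 0 by rewrite gt_eqF ?sqrtr_gt0 ?pi_gt0.
have pp : (pi : R) = Num.sqrt pi ^+ 2 by rewrite sqr_sqrtr// pi_ge0.
transitivity (- (- (2 / Num.sqrt pi * B1 t w) * mode_int1 f t)).
  congr (- _); rewrite /mode_int1 -RintegralZl; last 2 first.
  - exact: measurable_itv.
  - by apply: integrable_continuous_D; exact: continuous_mode_int1.
  apply: eq_Rintegral => theta _; rewrite /on_arc (sqrtrM _ (pi_ge0 R)).
  move: st sp; move: (Num.sqrt pi) (Num.sqrt t) => p r p0 r0.
  by field; rewrite p0 r0.
rewrite /mode_coef1 /noise1 [X in _ / (X / 2)]pp.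
move: sp; move: (Num.sqrt pi) => p p0.
by field.
Qed.

Lemma eta2E f t w : 0 < t -> eta2 B2 f t w = mode_coef2 f t * noise2 t w.
Proof.
move=> t0; rewrite /eta2 /field_of_fun.
have st : Num.sqrt t != 0 by rewrite gt_eqF ?sqrtr_gt0.
have p2 : 0 < (pi : R) / 2 by rewrite divr_gt0 ?pi_gt0.
have sp : Num.sqrt (pi / 2 : R) != 0 by rewrite gt_eqF ?sqrtr_gt0.
have pp : (pi / 2 : R) = Num.sqrt (pi / 2) ^+ 2 by rewrite sqr_sqrtr// ltW.
have tt : t = Num.sqrt t ^+ 2 by rewrite sqr_sqrtr// ltW.
have s2 : Num.sqrt (2 * pi * t ^+ 2) = 2 * Num.sqrt (pi / 2) * Num.sqrt t ^+ 2.
  rewrite (_ : 2 * pi * t ^+ 2 = (2 * t) ^+ 2 * (pi / 2)); last by field.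
  rewrite sqrtrM ?sqr_ge0// sqrtr_sqr ger0_norm ?mulr_ge0 ?(ltW t0)//.
  by rewrite -tt mulrAC.
transitivity (- (- (1 / (Num.sqrt (pi / 2) * Num.sqrt t) * B2 (t ^+ 2) w) * mode_int2 f t)).
  congr (- _); rewrite /mode_int2 -RintegralZl; last 2 first.
  - exact: measurable_itv.
  - by apply: integrable_continuous_D; exact: continuous_mode_int2.
  apply: eq_Rintegral => theta _; rewrite /on_arc s2.
  have -> : sin (2 * theta) = 2 * sin theta * cos theta.
    by rewrite (_ : 2 * theta = theta *+ 2) ?mulr_natl// sin_mulr2n -mulr_natl; ring.
  move: st sp; move: (Num.sqrt (pi / 2)) (Num.sqrt t) (B2 (t ^+ 2) w) => p r b p0 r0.
  by field; rewrite p0 r0.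
have -> : mode_coef2 f t = mode_int2 f t / (Num.sqrt t * Num.sqrt (pi / 2) ^+ 2) by rewrite -pp.
rewrite /noise2.
move: st sp; move: (Num.sqrt (pi / 2)) (Num.sqrt t) (B2 (t ^+ 2) w) => p r b p0 r0.
by field; rewrite p0 r0.
Qed.

(** With zero amplitudes allowed, every field that is conditioned, or whose modes are prescribed, is
    an instance. *)
Definition noisy (a1 a2 : R) : gfield R T :=
  add_field (add_field G a1 (eta1 B1)) a2 (eta2 B2).

Lemma noisyE a1 a2 f t : 0 < t -> noisy a1 a2 f t =
  G f t \+ ((fun w => a1 * mode_coef1 f t * Num.sqrt pi * B1 t w) \+
            (fun w => a2 * mode_coef2 f t * Num.sqrt (pi / 2) * B2 (t ^+ 2) w)).
Proof.
move=> t0; apply/funext => w; rewrite /noisy /add_field eta1E// eta2E// /noise1 /noise2/=.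
by rewrite addrA !mulrA.
Qed.

Lemma gspan_noisy a1 a2 f t : 0 < t -> gspan (noisy a1 a2 f t).
Proof.
move=> t0; rewrite noisyE//; apply: gspanD; first exact: gspan_G.
by apply: gspanD; apply: gspanZ; [apply: gspan_B1; exact: ltW|apply: gspan_B2; exact: sqr_ge0].
Qed.

Lemma rcov_noisy a1 a2 b1 b2 f t g t' : 0 < t -> 0 < t' ->
  rcov P (noisy a1 a2 f t) (noisy b1 b2 g t') = rcov P (G f t) (G g t')
   + a1 * b1 * (mode_coef1 f t * mode_coef1 g t' * mode_cov1 t t') + a2 * b2 * (mode_coef2 f t
       * mode_coef2 g t' * mode_cov2 t t').
Proof.
move=> t0 t'0; rewrite !noisyE//.
have hg s h : 0 < s -> G h s \in L2 by move=> s0; apply: gspan_Lfun2; exact: gspan_G.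
have h1 s : 0 < s -> B1 s \in L2 by move=> s0; apply: gspan_Lfun2; apply: gspan_B1; exact: ltW.
have h2 s : B2 (s ^+ 2) \in L2.
  by apply: gspan_Lfun2; apply: gspan_B2; exact: sqr_ge0.
have [g1 g2] := (hg t f t0, hg t' g t'0).
have [k1 k2] := (h1 t t0, h1 t' t'0).
have [l1 l2] := (h2 t, h2 t').
rewrite rcovDl ?Lfun2D ?Lfun2Z// !rcovDr ?Lfun2D ?Lfun2Z//.
rewrite !rcovDl ?Lfun2D ?Lfun2Z//.
rewrite !rcovZl ?Lfun2Z// !rcovZr// !rcov_G_B1 ?ltW// !rcov_G_B2 ?sqr_ge0//.
rewrite (rcovC _ (B1 t) (G g t')) (rcovC _ (B2 (t ^+ 2)) (G g t')) rcov_G_B1 ?ltW// rcov_G_B2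
    ?sqr_ge0//.
rewrite (rcovC _ (B2 (t ^+ 2)) (B1 t')) !rcov_B1_B2 ?sqr_ge0 ?ltW//.
rewrite (rcov_brownian hB1) ?ltW// (rcov_brownian hB2) ?sqr_ge0//.
rewrite /mode_cov1 /mode_cov2.
have pp : (pi : R) = Num.sqrt pi ^+ 2 by rewrite sqr_sqrtr// pi_ge0.
have pp2 : (pi / 2 : R) = Num.sqrt (pi / 2) ^+ 2.
  by rewrite sqr_sqrtr// divr_ge0// pi_ge0.
have [q qE] : exists q, q = Num.sqrt (pi : R) by exists (Num.sqrt pi).
have [q' qE'] : exists q, q = Num.sqrt (pi / 2 : R) by exists (Num.sqrt (pi / 2)).
rewrite -qE in pp *; rewrite -qE' in pp2 *.
rewrite pp2 pp; ring.
Qed.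

Lemma centered_gaussian_gspan (F : gfield R T) : (forall f t, 0 < t -> gspan (F f t)) ->
  centered_gaussian P F.
Proof.
move=> hF n c f t t0; apply: gspan_law.
elim: n c f t t0 => [|n IH] c f t t0.
  rewrite (_ : (fun w => _) = fun w => 0 * G 1 1 w).
    by apply: gspanZ; exact: gspan_G.
  by apply/funext => w; rewrite big_ord0 mul0r.
rewrite (_ : (fun w => _) = (fun w => \sum_(i < n) c (widen_ord (leqnSn n) i) *
    F (f (widen_ord (leqnSn n) i)) (t (widen_ord (leqnSn n) i)) w)
  \+ (fun w => c ord_max * F (f ord_max) (t ord_max) w)).
  apply: gspanD; last by apply: gspanZ; exact: hF.
  by apply: (IH (fun i => c _) (fun i => f _) (fun i => t _)) => i; exact: t0.
by apply/funext => w; rewrite big_ord_recr.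
Qed.

Lemma ae_sum n (c : 'I_n -> R) (X Y : 'I_n -> T -> R) :
  (forall i, X i = Y i %[ae P]) ->
  (fun w => \sum_(i < n) c i * X i w) = (fun w => \sum_(i < n) c i * Y i w) %[ae P].
Proof.
elim: n c X Y => [|n IH] c X Y XY.
  by apply: aeW => w _; rewrite !big_ord0.
have h1 := IH (fun i => c (widen_ord (leqnSn n) i)) _ _ (fun i => XY (widen_ord (leqnSn n) i)).
have h2 := XY ord_max.
by apply: filterS2 h1 h2 => w h1 h2 _; rewrite !big_ord_recr/= (h1 I) (h2 I).
Qed.

Lemma noisy_field (a b a1 a2 : R) : a - 1 = a1 ^+ 2 -> b - 2 = a2 ^+ 2 ->
  gaussian_field_with_kernel P (noisy a1 a2) (Cab_kernel a b).
Proof.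
move=> ea eb; split.
  by apply: centered_gaussian_gspan => f t; exact: gspan_noisy.
move=> f g t t' t0 t'0.
rewrite covariance_rcov; try by apply: gspan_Lfun2; exact: gspan_noisy.
rewrite rcov_noisy// Cab_covariance_u//; congr EFin.
by rewrite -!expr2 -ea -eb; ring.
Qed.

Section conditioned.
(* p1, p2 tell which modes are conditioned to be 0; the conditioned field carries
   no noise in those modes. *)
Variables (p1 p2 : bool) (a1 a2 b1 b2 : R).
Hypotheses (p1a : p1 -> a1 = 0) (p2a : p2 -> a2 = 0).
Let F := noisy a1 a2.
Let F' := noisy b1 b2.
Let S : set (T -> R) :=
  [set Z | (p1 /\ first_modes F' Z) \/ (p2 /\ second_modes F' Z)].
Let k1 : R := p1%:R / (1 + b1 ^+ 2).
Let k2 : R := p2%:R / (1 + b2 ^+ 2).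

(** The candidate handed to [orth_projP]. [F' 1 t] and [F' 'X t] replace the modes at t, of which
    they are nonzero multiples. *)
Let Y0 f t : T -> R := (fun w => k1 * mode_coef1 f t * F' 1 t w) \+ (fun w => k2 * mode_coef2 f
    t * F' 'X t w).

Let nb (x : R) : 1 + x ^+ 2 != 0.
Proof. by rewrite gt_eqF// ltr_pwDl// sqr_ge0. Qed.

Let first_modeE t : first_mode F' t = fun w => - (2 * Num.sqrt t)^-1 * F' 1 t w.
Proof. by apply/funext => w; rewrite /first_mode mulNr mulNr mulrC. Qed.

Let second_modeE t : second_mode F' t = fun w => - (2 * t)^-1 * F' 'X t w.
Proof. by apply/funext => w; rewrite /second_mode mulNr mulNr mulrC. Qed.

Let gF f t : 0 < t -> gspan (F f t). Proof. exact: gspan_noisy. Qed.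
Let gF' f t : 0 < t -> gspan (F' f t). Proof. exact: gspan_noisy. Qed.

Let gspan_S Z : S Z -> gspan Z.
Proof.
move=> [[_ [t t0 <-]]|[_ [t t0 <-]]].
  by rewrite first_modeE; apply: gspanZ; exact: gF'.
by rewrite second_modeE; apply: gspanZ; exact: gF'.
Qed.

Let gspan_Y0 f t : 0 < t -> gspan (Y0 f t).
Proof. by move=> t0; apply: gspanD; apply: gspanZ; exact: gF'. Qed.

Let span_Y0 f t : 0 < t -> linear_span S (Y0 f t).
Proof.
move=> t0; have st : Num.sqrt t != 0 by rewrite gt_eqF ?sqrtr_gt0.
have nt := lt0r_neq0 t0.
apply: linear_spanD.
- have [hp|hp] := boolP p1.
    have -> : k1 = 1 / (1 + b1 ^+ 2) by rewrite /k1 hp.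
    rewrite (_ : (fun w => _) = fun w => - (2 * Num.sqrt t * (1 / (1 + b1 ^+ 2) * mode_coef1 f
        t)) * first_mode F' t w).
      by apply: linear_spanZ; apply: linear_span_sub; left; split => //; exists t.
    apply/funext => w; rewrite first_modeE.
    by have := nb b1; move: (1 + b1 ^+ 2) => q q0; field; rewrite st q0.
  rewrite (_ : (fun w => _) = cst 0); first exact: linear_span0.
  by apply/funext => w; rewrite /k1 (negbTE hp) !mul0r.
- have [hp|hp] := boolP p2.
    have -> : k2 = 1 / (1 + b2 ^+ 2) by rewrite /k2 hp.
    rewrite (_ : (fun w => _) = fun w => - (2 * t * (1 / (1 + b2 ^+ 2) * mode_coef2 f t)) *
        second_mode F' t w).
      by apply: linear_spanZ; apply: linear_span_sub; right; split => //; exists t.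
    apply/funext => w; rewrite second_modeE.
    by have := nb b2; move: (1 + b2 ^+ 2) => q q0; field; rewrite nt q0.
  rewrite (_ : (fun w => _) = cst 0); first exact: linear_span0.
  by apply/funext => w; rewrite /k2 (negbTE hp) !mul0r.
Qed.

Let rcovL1 f t t' : 0 < t -> 0 < t' ->
  rcov P (F f t) (F' 1 t') = (1 + a1 * b1) * (mode_coef1 f t * mode_cov1 t t').
Proof.
by move=> t0 t'0; rewrite rcov_noisy// rcov_G1// mode_coef1_1 mode_coef2_1; ring.
Qed.

Let rcovLX f t t' : 0 < t -> 0 < t' ->
  rcov P (F f t) (F' 'X t') = (1 + a2 * b2) * (mode_coef2 f t * mode_cov2 t t').
Proof.
by move=> t0 t'0; rewrite rcov_noisy// rcov_GX// mode_coef1_X mode_coef2_X//; ring.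
Qed.

Let rcov11 t t' : 0 < t -> 0 < t' -> rcov P (F' 1 t) (F' 1 t') = (1 + b1 ^+ 2) * mode_cov1 t t'.
Proof. by move=> t0 t'0; rewrite rcov_noisy// rcov_G1// !mode_coef1_1 !mode_coef2_1; ring. Qed.

Let rcovX1 t t' : 0 < t -> 0 < t' -> rcov P (F' 'X t) (F' 1 t') = 0.
Proof. by move=> t0 t'0; rewrite rcov_noisy// rcov_G1// !mode_coef1_1 !mode_coef2_1
    !mode_coef1_X; ring. Qed.

Let rcovXX t t' : 0 < t -> 0 < t' -> rcov P (F' 'X t) (F' 'X t') = (1 + b2 ^+ 2) * mode_cov2 t t'.
Proof. by move=> t0 t'0; rewrite rcov_noisy// rcov_GX// !mode_coef1_X !mode_coef2_X//; ring. Qed.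

Let L2F f t : 0 < t -> F f t \in L2.
Proof. by move=> t0; apply: gspan_Lfun2; exact: gF. Qed.
Let L2F' f t : 0 < t -> F' f t \in L2.
Proof. by move=> t0; apply: gspan_Lfun2; exact: gF'. Qed.
Let L2Y f t : 0 < t -> Y0 f t \in L2.
Proof. by move=> t0; apply: gspan_Lfun2; exact: gspan_Y0. Qed.

Let rcovY0 f t Z : 0 < t -> Z \in L2 -> rcov P (Y0 f t) Z =
  k1 * mode_coef1 f t * rcov P (F' 1 t) Z + k2 * mode_coef2 f t * rcov P (F' 'X t) Z.
Proof.
move=> t0 Z2.
rewrite /Y0 (rcovDl (Lfun2Z (k1 * mode_coef1 f t) (L2F' 1 t0)) (Lfun2Z (k2 * mode_coef2 f t)
    (L2F' 'X t0)) Z2).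
by rewrite (rcovZl _ (L2F' 1 t0) Z2) (rcovZl _ (L2F' 'X t0) Z2).
Qed.

(** Against the first mode at t', F and [Y0] have covariances proportional to
    [mode_coef1 f t * mode_cov1 t t'], with factors 1 + a1 b1 and k1 (1 + b1^2). Both equal 1 since
    a conditioned mode has a1 = 0, and this for every t' at once; likewise for the second mode. *)
Let orthS f t Z : 0 < t -> S Z -> rcov P (F f t \- Y0 f t) Z = 0.
Proof.
move=> t0 [[hp [t' t'0 <-]]|[hp [t' t'0 <-]]].
- have a10 := p1a hp.
  rewrite first_modeE rcovZr ?Lfun2B ?L2F ?L2Y ?L2F'// rcovBl ?L2F ?L2Y ?L2F'//.
  rewrite rcovY0 ?L2F'//.
  have -> : k1 = 1 / (1 + b1 ^+ 2) by rewrite /k1 hp.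
  have st' : Num.sqrt t' != 0 by rewrite gt_eqF ?sqrtr_gt0.
  rewrite rcovL1// rcov11// rcovX1// a10.
  by have := nb b1; move: (1 + b1 ^+ 2) => q q0; field; rewrite q0 st'.
- have a20 := p2a hp.
  rewrite second_modeE rcovZr ?Lfun2B ?L2F ?L2Y ?L2F'// rcovBl ?L2F ?L2Y ?L2F'//.
  rewrite rcovY0 ?L2F'//.
  have -> : k2 = 1 / (1 + b2 ^+ 2) by rewrite /k2 hp.
  have nt' : t' != 0 by exact: lt0r_neq0.
  rewrite rcovLX// rcovXX// (rcovC _ (F' 1 t)) rcovX1// a20.
  by have := nb b2; move: (1 + b2 ^+ 2) => q q0; field; rewrite q0 nt'.
Qed.

Let cond f t : 0 < t -> conditioned P F S f t \in L2 /\
  conditioned P F S f t = F f t \- Y0 f t %[ae P].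
Proof.
move=> t0.
have S2 Z : S Z -> Z \in L2 by move=> /gspan_S; exact: gspan_Lfun2.
have S0 Z : S Z -> ('E_P[Z] = 0)%E by move=> /gspan_S; exact: gspan_expectation.
have [h1 h2] := orth_projP S2 S0 (L2F f t0) (span_Y0 f t0) (fun Z => @orthS f t Z t0).
split; first by apply: Lfun2B => //; exact: L2F.
by apply: filterS h2 => w h _; rewrite /conditioned/= (h I).
Qed.

Lemma conditioned_field (a b : R) : 1 - a = k1 - a1 ^+ 2 -> 2 - b = k2 - a2 ^+ 2 ->
  gaussian_field_with_kernel P (conditioned P F S) (Cab_kernel a b).
Proof.
move=> ea eb; pose W : gfield R T := fun f t => F f t \- Y0 f t.
have gW f t : 0 < t -> gspan (W f t).
  move=> t0; rewrite (_ : W f t = F f t \+ (fun w => -1 * Y0 f t w)).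
    by apply: gspanD; [exact: gF|apply: gspanZ; exact: gspan_Y0].
  by apply/funext => w; rewrite /W/= mulN1r.
split.
- move=> n c f t t0; have [s hs] := centered_gaussian_gspan gW c f t0.
  exists s; apply: (ae_has_centered_normal_law hs).
    apply: measurable_sum => i; apply: measurable_funM => //.
    by have [h _] := cond (f i) (t0 i); exact: Lfun2_measurable h.
  apply: ae_sum => i; have [_ h] := cond (f i) (t0 i).
  by apply: filterS h => w h /h ->.
- move=> f g t t' t0 t'0.
  have [c1 c2] := cond f t0; have [c1' c2'] := cond g t'0.
  have w1 : W f t \in L2 by apply: gspan_Lfun2; exact: gW.
  have w2 : W g t' \in L2 by apply: gspan_Lfun2; exact: gW.
  rewrite (ae_covariance c1 w1 c1' c2) covarianceC (ae_covariance c1' w2 w1 c2').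
  rewrite covariance_rcov//; congr EFin; rewrite rcovC /W.
  rewrite rcovBr ?Lfun2B ?L2F ?L2Y//.
  have S2 Z : S Z -> Z \in L2 by move=> /gspan_S; exact: gspan_Lfun2.
  (* W(f, t) is orthogonal to the projection part of W(g, t'), so only its covariance with F(g, t')
     remains. *)
  rewrite (orth_linear_span S2 (L2F f t0) (span_Y0 f t0) (fun Z => @orthS f t Z t0) (span_Y0 g
      t'0)) subr0.
  rewrite rcovBl ?L2F ?L2Y// rcovY0 ?L2F//.
  rewrite (rcovC _ (F' 1 t)) (rcovC _ (F' 'X t)) rcovL1// rcovLX// rcov_noisy// Cab_covariance_u//.
  rewrite ea eb /mode_cov1 /mode_cov2 (minC t') (minC (t' ^+ 2)).
  (* Either the mode is conditioned and a1 = 0, or it is not and k1 = 0; this removes the cross term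
     k1 a1 b1 between [Y0] and F. *)
  have e1 : k1 * a1 = 0.
    by rewrite /k1; case: (boolP p1) => [/p1a ->|_]; rewrite ?mulr0// !mul0r.
  have e2 : k2 * a2 = 0.
    by rewrite /k2; case: (boolP p2) => [/p2a ->|_]; rewrite ?mulr0// !mul0r.
  set m1 := Num.min _ _; set m2 := Num.min _ _.
  apply/eqP; rewrite -subr_eq0; apply/eqP.
  transitivity (- (k1 * a1) * b1 * mode_coef1 f t * mode_coef1 g t' * pi * m1
    - (k2 * a2) * b2 * mode_coef2 f t * mode_coef2 g t' * (pi / 2) * m2); first by ring.
  by rewrite e1 e2 oppr0 !mul0r subrr.
Qed.

End conditioned.

End noisy_fields.

(** * The cases of the theorem *)

Lemma field_corresponds (R : realType) d (T : measurableType d) (P : probability T R)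
    d' (T' : measurableType d') (P' : probability T' R) k (F : gfield R T) (F' : gfield R T') :
  gaussian_field_with_kernel P F k -> gaussian_field_with_kernel P' F' k ->
  corresponds P P' F F'.
Proof.
move=> [gF cF] [gF' cF']; split => // f g t t' t0 t'0.
by rewrite cF// cF'.
Qed.

Section noisy_special.
Context (R : realType) (d : measure_display) (T : measurableType d)
  (G : gfield R T) (B1 B2 : R -> T -> R).

Lemma noisy00 : noisy G B1 B2 0 0 = G.
Proof.
apply/funext => f; apply/funext => t; apply/funext => w.
by rewrite /noisy /add_field !mul0r !addr0.
Qed.

Lemma noisy_r0 a1 : noisy G B1 B2 a1 0 = add_field G a1 (eta1 B1).
Proof.
apply/funext => f; apply/funext => t; apply/funext => w.
by rewrite /noisy /add_field !mul0r !addr0.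
Qed.

Lemma noisy_0r a2 : noisy G B1 B2 0 a2 = add_field G a2 (eta2 B2).
Proof.
apply/funext => f; apply/funext => t; apply/funext => w.
by rewrite /noisy /add_field !mul0r !addr0.
Qed.

Lemma modes_tt (A B : set (T -> R)) : [set Z | (true /\ A Z) \/ (true /\ B Z)] = A `|` B.
Proof. by apply/seteqP; split => Z /= [] h; [left|right|left|right] => //; case: h. Qed.

Lemma modes_tf (A B : set (T -> R)) : [set Z | (true /\ A Z) \/ (false /\ B Z)] = A.
Proof. by apply/seteqP; split => Z /= => [[[]|[]]|]//; left. Qed.

Lemma modes_ft (A B : set (T -> R)) : [set Z | (false /\ A Z) \/ (true /\ B Z)] = B.
Proof. by apply/seteqP; split => Z /= => [[[]|[]]|]//; right. Qed.

End noisy_special.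

Theorem theorem1p6 (R : realType) (d : measure_display) (T : measurableType d)
    (P : probability T R) (a b : R) (ha : 0 <= a) (hb : 1 <= b)
    (G : gfield R T) (hG : gaussian_field_with_kernel P G gff_kernel)
    (B1 B2 : R -> T -> R)
    (hB1 : brownian_motion P B1) (hB2 : brownian_motion P B2)
    (hind : independent_noises P G B1 B2) :
  (exists C0 : gfield R T, gaussian_field_with_kernel P C0 (Cab_kernel a b)) /\
  forall (d' : measure_display) (T' : measurableType d')
    (P' : probability T' R) (C : gfield R T'),
    gaussian_field_with_kernel P' C (Cab_kernel a b) ->
  [/\ (* 1 *)
      a = 1 -> b = 2 -> corresponds P' P C G,
      (* 2 *)
      [/\ a = 0 -> b = 1 ->
            corresponds P' P C
              (conditioned P G (first_modes G `|` second_modes G)),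
          a = 0 -> b = 2 ->
            corresponds P' P C (conditioned P G (first_modes G)) &
          a = 1 -> b = 1 ->
            corresponds P' P C (conditioned P G (second_modes G))],
      (* 3 *)
      1 <= a -> 2 <= b ->
        corresponds P' P C
          (add_field (add_field G (Num.sqrt (a - 1)) (eta1 B1))
                     (Num.sqrt (b - 2)) (eta2 B2)),
      (* 4 *)
      a < 1 -> b < 2 ->
        let F := add_field (add_field G (Num.sqrt (a / (1 - a))) (eta1 B1))
                           (Num.sqrt ((b - 1) / (2 - b))) (eta2 B2) in
        corresponds P' P C
          (conditioned P G (first_modes F `|` second_modes F)) &
      (* 5 *)
      (a < 1 -> 2 <= b ->
        corresponds P' P C
          (conditioned P (add_field G (Num.sqrt (b - 2)) (eta2 B2))
            (first_modes
              (add_field G (Num.sqrt (a / (1 - a))) (eta1 B1))))) /\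
      (1 <= a -> b < 2 ->
        corresponds P' P C
          (conditioned P (add_field G (Num.sqrt (a - 1)) (eta1 B1))
            (second_modes
              (add_field G (Num.sqrt ((b - 1) / (2 - b))) (eta2 B2)))))].
Proof.
have noise a1 a2 := @noisy_field R d T P G hG B1 B2 hB1 hB2 hind a b a1 a2.
have cond p1 p2 a1 a2 b1 b2 h1 h2 :=
  @conditioned_field R d T P G hG B1 B2 hB1 hB2 hind p1 p2 a1 a2 b1 b2 h1 h2 a b.
(* With x^2 = a / (1 - a) one has 1 + x^2 = 1 / (1 - a), so the weight of the projection is 1 - a;
   in [kb] it is 2 - b for the same reason. *)
have ka : a < 1 -> 1 - a = true%:R / (1 + Num.sqrt (a / (1 - a)) ^+ 2) - 0 ^+ 2.
  move=> a1; have a0 : 1 - a != 0 by rewrite gt_eqF// subr_gt0.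
  rewrite sqr_sqrtr ?divr_ge0 ?subr_ge0 ?(ltW a1)//.
  by rewrite mulr1n; field; rewrite a0/=; lra.
have kb : b < 2 -> 2 - b = true%:R / (1 + Num.sqrt ((b - 1) / (2 - b)) ^+ 2) - 0 ^+ 2.
  move=> b2; have b0 : 2 - b != 0 by rewrite gt_eqF// subr_gt0.
  rewrite sqr_sqrtr ?divr_ge0 ?subr_ge0 ?(ltW b2)//.
  by rewrite mulr1n; field; rewrite b0/=; lra.
have ka' : 1 <= a -> 1 - a = false%:R / (1 + 0 ^+ 2) - Num.sqrt (a - 1) ^+ 2.
  by move=> a1; rewrite sqr_sqrtr ?subr_ge0// mul0r sub0r opprB.
have kb' : 2 <= b -> 2 - b = false%:R / (1 + 0 ^+ 2) - Num.sqrt (b - 2) ^+ 2.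
  by move=> b2; rewrite sqr_sqrtr ?subr_ge0// mul0r sub0r opprB.
pose x1 := Num.sqrt (a / (1 - a)); pose x2 := Num.sqrt ((b - 1) / (2 - b)).
pose y1 := Num.sqrt (a - 1); pose y2 := Num.sqrt (b - 2).
have part3 : 1 <= a -> 2 <= b ->
    gaussian_field_with_kernel P (noisy G B1 B2 y1 y2) (Cab_kernel a b).
  by move=> a1 b2; apply: noise; rewrite sqr_sqrtr// subr_ge0.
have part4 : a < 1 -> b < 2 -> gaussian_field_with_kernel P
    (conditioned P G (first_modes (noisy G B1 B2 x1 x2) `|` second_modes (noisy G B1 B2 x1 x2)))
    (Cab_kernel a b).
  move=> a1 b2; have := cond true true 0 0 x1 x2 (fun=> erefl) (fun=> erefl) (ka a1) (kb b2).
  by rewrite noisy00 modes_tt.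
have part5 : a < 1 -> 2 <= b -> gaussian_field_with_kernel P
    (conditioned P (add_field G y2 (eta2 B2)) (first_modes (add_field G x1 (eta1 B1))))
    (Cab_kernel a b).
  move=> a1 b2; have := cond true false 0 y2 x1 0 (fun=> erefl) (fun h => False_ind _ (notF h)) (ka a1) (kb' b2).
  by rewrite noisy_0r noisy_r0 modes_tf.
have part5' : 1 <= a -> b < 2 -> gaussian_field_with_kernel P
    (conditioned P (add_field G y1 (eta1 B1)) (second_modes (add_field G x2 (eta2 B2))))
    (Cab_kernel a b).
  move=> a1 b2; have := cond false true y1 0 0 x2 (fun h => False_ind _ (notF h)) (fun=> erefl) (ka' a1) (kb b2).
  by rewrite noisy_0r noisy_r0 modes_ft.
(* At these boundary parameters a noise disappears, which makes points 1 and 2 special cases of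
   points 3 to 5. *)
have z1 : a = 0 -> x1 = 0 by move=> a0; rewrite /x1 a0 mul0r sqrtr0.
have z2 : b = 1 -> x2 = 0 by move=> b1; rewrite /x2 b1 subrr mul0r sqrtr0.
have z3 : a = 1 -> y1 = 0 by move=> a1; rewrite /y1 a1 subrr sqrtr0.
have z4 : b = 2 -> y2 = 0 by move=> b2; rewrite /y2 b2 subrr sqrtr0.
split.
  (* The four ranges of (a, b) exhaust the parameters, and the fields built on the given space
     witness existence. *)
  have [a1|a1] := ltP a 1; have [b2|b2] := ltP b 2.
  - by eexists; exact: part4.
  - by eexists; exact: part5.
  - by eexists; exact: part5'.
  - by eexists; exact: part3.
move=> d' T' P' C hC; split.
- move=> a1 b2; apply: (field_corresponds hC).
  by rewrite -(noisy00 G B1 B2) -{1}(z3 a1) -(z4 b2); apply: part3; rewrite ?a1 ?b2.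
- split.
  + move=> a0 b1; apply: (field_corresponds hC).
    have := part4; rewrite (z1 a0) (z2 b1) noisy00; apply; [by rewrite a0 ltr01|].
    by rewrite b1 ltr1n.
  + move=> a0 b2; apply: (field_corresponds hC).
    have := part5; rewrite (z1 a0) (z4 b2) -(noisy_0r G B1 B2) -(noisy_r0 G B1 B2) noisy00.
    by apply; rewrite ?a0 ?b2 ?ltr01.
  + move=> a1 b1; apply: (field_corresponds hC).
    have := part5'; rewrite (z3 a1) (z2 b1) -(noisy_0r G B1 B2) -(noisy_r0 G B1 B2) noisy00.
    by apply; rewrite ?a1 ?b1 ?ltr1n.
- by move=> a1 b2; apply: (field_corresponds hC); exact: part3.
- by move=> a1 b2 F; apply: (field_corresponds hC); exact: part4.
- by split => a1 b2; apply: (field_corresponds hC); [exact: part5|exact: part5'].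
Qed.
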